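(* Let $\Gamma$ be a discrete abelian group such that $C^*(\Gamma)$ satisfies the following representation connectedness property: there exists an infinite-dimensional Hilbert space $\mathcal{H}$ such that there is a continuous path within $\mathrm{Hom}(C^*(\Gamma),B(\mathcal{H})\otimes C^*(\Gamma))$ connecting $\mathrm{id}^{\oplus\mathcal{H}}\oplus\mathrm{inv}^{\oplus\mathcal{H}}\oplus\mathrm{triv}^{\oplus\mathcal{H}}$ to $\mathrm{triv}^{\oplus\mathcal{H}}$. Then there exists a Type 2 counterexample for the compact quantum group $C^*(\Gamma)$ coacting on $A:=B(\mathcal{H})\otimes C^*(\Gamma)$ through the right tensorand; that is, for the free coaction $\delta=\mathrm{id}_{B(\mathcal{H})}\otimes\Delta$ of $C^*(\Gamma)$ on $A$, there exists a $(\Delta,\delta_\Delta)$-equivariant unital $*$-homomorphism $C^*(\Gamma)\to A\circledast^{\delta}C^*(\Gamma)$.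
   Context: All tensor products of $C^*$-algebras are minimal. $C^*(\Gamma)$ is a compact quantum group with $\Delta(\gamma)=\gamma\otimes\gamma$ for $\gamma\in\Gamma$. For a coaction $\delta:A\to A\otimes H$ of a compact quantum group $(H,\Delta)$ on a unital $C^*$-algebra $A$, the equivariant join is $A \circledast^{\delta} H := \{f\in C([0,1],A\otimes H): f(0)\in\delta(A),\ f(1)\in\mathbb{C}\otimes H\}$, with induced coaction $(\delta_\Delta f)(t) = (\mathrm{id}_A\otimes\Delta)(f(t))$. A coaction is free if it is injective and the closed linear span of $\{(a\otimes 1)\delta(b):a,b\in A\}$ is $A\otimes H$. The Type 2 noncommutative Borsuk–Ulam conjecture asserts that if $\delta$ is a free coaction of nontrivial $(H,\Delta)$ on $A$, there is no $(\Delta,\delta_\Delta)$-equivariant unital $*$-homomorphism $H\to A\circledast^\delta H$. For a unital $C^*$-algebra $B$, $\mathrm{Hom}(C^*(\Gamma),B)$ is the space of unital $*$-homomorphisms with the pointwise norm topology. The maps $\mathrm{id},\mathrm{inv},\mathrm{triv}$ are the endomorphisms of $C^*(\Gamma)$ induced by $\gamma\mapsto\gamma$, $\gamma\mapsto\gamma^{-1}$, $\gamma\mapsto 1$. For an endomorphism $\sigma$ of $C^*(\Gamma)$, $\sigma^{\oplus\mathcal{H}}$ denotes $a\mapsto 1_{B(\mathcal{H})}\otimes\sigma(a)\in B(\mathcal{H})\otimes C^*(\Gamma)$. Direct sums are viewed again as maps into $B(\mathcal{H})\otimes C^*(\Gamma)$ through an identification $\mathcal{H}\oplus\mathcal{H}\oplus\mathcal{H}\cong\mathcal{H}$;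 thus $\mathrm{id}^{\oplus\mathcal{H}}\oplus\mathrm{inv}^{\oplus\mathcal{H}}\oplus\mathrm{triv}^{\oplus\mathcal{H}}$ sends $\gamma$ to $P_1\otimes\gamma+P_2\otimes\gamma^{-1}+P_3\otimes 1$, where $P_1,P_2,P_3$ are the projections onto the three summands. *)

(* Defs.v *)
(* The scalars are the complex numbers R[i] over a realType R.  Norms are R[i]-valued;
   x <= y in R[i] means that y - x is a nonnegative real. *)
From HB Require Import structures.
From mathcomp Require Import all_boot all_order all_algebra.
From mathcomp Require Import complex.
From mathcomp Require Import all_classical all_reals all_analysis.

Set Implicit Arguments.
Unset Strict Implicit.
Unset Printing Implicit Defensive.

Import Order.TTheory GRing.Theory Num.Theory.
Import numFieldNormedType.Exports.

Local Open Scope classical_set_scope.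
Local Open Scope ring_scope.

(* MathComp's hierarchy has no structure that is at once a normed module and a ring
   (only number domains are), so the product is part of the mixin and the usual ring
   notations are obtained from the instances below. *)
HB.mixin Record isCStarAlgebra (R : realType) A
    of CompleteNormedModule R[i] A := {
  cstar_mul : A -> A -> A ;
  cstar_one : A ;
  cstar_mulA : associative cstar_mul ;
  cstar_mul1l : left_id cstar_one cstar_mul ;
  cstar_mul1r : right_id cstar_one cstar_mul ;
  cstar_mulDl : left_distributive cstar_mul +%R ;
  cstar_mulDr : right_distributive cstar_mul +%R ;
  cstar_one_neq0 : cstar_one != 0 ;
  cstar_scaleAl : forall (k : R[i]) (a b : A),
    k *: cstar_mul a b = cstar_mul (k *: a) b ;
  cstar_scaleAr : forall (k : R[i]) (a b : A),
    k *: cstar_mul a b = cstar_mul a (k *: b) ;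
  star : A -> A ;
  starK : involutive star ;
  starP : forall (k : R[i]) (a b : A),
    star (k *: a + b) = k^* *: star a + star b ;
  starM : forall a b : A, star (cstar_mul a b) = cstar_mul (star b) (star a) ;
  cstar_normM : forall a b : A, `|cstar_mul a b| <= `|a| * `|b| ;
  cstar_norm : forall a : A, `|cstar_mul (star a) a| = `|a| ^+ 2
}.

#[short(type="cstarType")]
HB.structure Definition CStarAlgebra (R : realType) :=
  {A of CompleteNormedModule R[i] A & isCStarAlgebra R A}.

#[non_forgetful_inheritance]
HB.instance Definition _ (R : realType) (A : cstarType R) :=
  GRing.Zmodule_isNzRing.Build (CStarAlgebra.sort A) (@cstar_mulA R A)
    (@cstar_mul1l R A) (@cstar_mul1r R A) (@cstar_mulDl R A) (@cstar_mulDr R A)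
    (@cstar_one_neq0 R A).
#[non_forgetful_inheritance]
HB.instance Definition _ (R : realType) (A : cstarType R) :=
  GRing.Lmodule_isLalgebra.Build R[i] (CStarAlgebra.sort A) (@cstar_scaleAl R A).
#[non_forgetful_inheritance]
HB.instance Definition _ (R : realType) (A : cstarType R) :=
  GRing.Lalgebra_isAlgebra.Build R[i] (CStarAlgebra.sort A) (@cstar_scaleAr R A).

(* The inner product is linear in its first argument. *)
HB.mixin Record isHilbert (R : realType) H of CompleteNormedModule R[i] H := {
  inner : H -> H -> R[i] ;
  innerP : forall (k : R[i]) (x y z : H),
    inner (k *: x + y) z = k * inner x z + inner y z ;
  innerC : forall x y : H, inner y x = (inner x y)^* ;
  inner_norm : forall x : H, `|x| ^+ 2 = inner x x
}.

#[short(type="hilbertType")]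
HB.structure Definition Hilbert (R : realType) :=
  {H of CompleteNormedModule R[i] H & isHilbert R H}.

Definition lspan (R : realType) (V : lmodType R[i]) (S : set V) : set V :=
  [set v | exists2 s : seq (R[i] * V), (forall p, p \in s -> S p.2)
                                     & v = \sum_(p <- s) p.1 *: p.2].

Definition infinite_dimensional (R : realType) (H : hilbertType R) : Prop :=
  forall s : seq H, lspan [set` s] <> setT.

Section StarHom.
Context {R : realType}.

Definition star_hom (C D : cstarType R) : set (C -> D) :=
  [set f | [/\ linear f, f 1 = 1, (forall a b, f (a * b) = f a * f b)
             & (forall a, f (star a) = star (f a))]].

Definition unitary (D : cstarType R) : set D :=
  [set v | star v * v = 1 /\ v * star v = 1].

(* The topology of pointwise norm convergence on Hom(C, D) is the one induced by
   {ptws C -> D}. *)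
Definition hom_path (C D : cstarType R) (f g : C -> D) : Prop :=
  exists phi : R -> {ptws C -> D},
    [/\ {within `[0 : R, 1 : R], continuous phi},
        (forall t : R, t \in `[0, 1] -> star_hom (phi t)),
        phi 0 = f & phi 1 = g].

Definition bounded_operator (H : hilbertType R) : set (H -> H) :=
  [set T | linear T /\ exists M : R[i], forall x, `|T x| <= M * `|x|].

Definition representation (A : cstarType R) (H : hilbertType R)
    : set (A -> H -> H) :=
  [set pi | (forall a, bounded_operator (pi a)) /\
    [/\ (forall (k : R[i]) a b x, pi (k *: a + b) x = k *: pi a x + pi b x),
        (forall x, pi 1 x = x),
        (forall a b x, pi (a * b) x = pi a (pi b x))
      & (forall a x y, inner (pi a x) y = inner x (pi (star a) y))]].

End StarHom.

(* The C*-algebra B(H): its identity representation on H is isometric for the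
   operator norm and reaches every bounded operator. *)
Record bounded_operators (R : realType) (H : hilbertType R) := BoundedOperators {
  bo_alg :> cstarType R ;
  bo_act : bo_alg -> H -> H ;
  bo_rep : representation bo_act ;
  bo_norm : forall (T : bo_alg) (M : R[i]), 0 <= M ->
    (`|T| <= M) <-> (forall x, `|bo_act T x| <= M * `|x|) ;
  bo_surj : forall T : H -> H, bounded_operator T -> exists a, bo_act a = T
}.

Definition unitary_representation (R : realType) (G : zmodType)
    (D : cstarType R) (v : G -> D) : Prop :=
  (forall g, unitary (v g)) /\ (forall g h, v (g + h) = v g * v h).

(* C*(G) for a discrete abelian group G, written additively, given by its canonical
   unitaries and its universal property. *)
Record group_cstar (R : realType) (G : zmodType) := GroupCStar {
  gc_alg :> cstarType R ;
  gc_u : G -> gc_alg ;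
  gc_unitary : unitary_representation gc_u ;
  gc_universal : forall (D : cstarType R) (v : G -> D),
    unitary_representation v ->
    exists! f : gc_alg -> D, star_hom f /\ forall g, f (gc_u g) = v g
}.

Section GroupCStarMaps.
Context {R : realType} {G : zmodType} (C : group_cstar R G).

Definition gc_lift (D : cstarType R) (v : G -> D) : C -> D :=
  get [set f | star_hom f /\ forall g, f (gc_u C g) = v g].

Definition gc_id : C -> C := gc_lift (fun g => gc_u C g).
Definition gc_inv : C -> C := gc_lift (fun g => gc_u C (- g)).
Definition gc_triv : C -> C := gc_lift (fun=> 1).

End GroupCStarMaps.

Arguments gc_lift {R G C D} v _.
Arguments gc_id {R G} C _.
Arguments gc_inv {R G} C _.
Arguments gc_triv {R G} C _.

(* For xi = [:: (x_1, y_1); ...], the squared norm of \sum_j x_j ⊗ y_j in the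
   Hilbert space tensor product, where <x ⊗ y, x' ⊗ y'> = <x, x'> <y, y'>. *)
Definition tensor_norm2 (R : realType) (H K : hilbertType R) (xi : seq (H * K))
    : R[i] :=
  \sum_(p <- xi) \sum_(q <- xi) inner p.1 q.1 * inner p.2 q.2.

(* The operator \sum_k pi(a_k) ⊗ rho(b_k) applied to \sum_j x_j ⊗ y_j. *)
Definition tensor_apply (A B H K : Type) (pi : A -> H -> H) (rho : B -> K -> K)
    (s : seq (A * B)) (xi : seq (H * K)) : seq (H * K) :=
  [seq (pi p.1 x.1, rho p.2 x.2) | p <- s, x <- xi].

(* The C*-algebra A ⊗ B: mt_norm says that the norm of \sum_k a_k ⊗ b_k is the
   supremum, over all representations pi of A and rho of B, of the operator norm of
   \sum_k pi(a_k) ⊗ rho(b_k), which is computed on the dense space of finite sums of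
   elementary tensors. *)
Record min_tensor (R : realType) (A B : cstarType R) := MinTensor {
  mt_alg :> cstarType R ;
  mt_tens : A -> B -> mt_alg ;
  mt_linl : forall b, linear (mt_tens^~ b) ;
  mt_linr : forall a, linear (mt_tens a) ;
  mt_1 : mt_tens 1 1 = 1 ;
  mt_M : forall a a' b b',
    mt_tens (a * a') (b * b') = mt_tens a b * mt_tens a' b' ;
  mt_star : forall a b, mt_tens (star a) (star b) = star (mt_tens a b) ;
  mt_dense : closure (lspan [set mt_tens a b | a in setT & b in setT]) = setT ;
  mt_norm : forall (s : seq (A * B)) (M : R[i]), 0 <= M ->
    `|\sum_(p <- s) mt_tens p.1 p.2| <= M <->
    (forall (H K : hilbertType R) (pi : A -> H -> H) (rho : B -> K -> K),
       representation pi -> representation rho ->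
       forall xi : seq (H * K),
         tensor_norm2 (tensor_apply pi rho s xi) <= M ^+ 2 * tensor_norm2 xi)
}.

(* Minimal tensor products are unique up to a unique isomorphism compatible with
   elementary tensors; tensor_products is a choice of A ⊗ B for all A and B. *)
Definition tensor_products (R : realType) :=
  forall A B : cstarType R, min_tensor A B.

Section Coactions.
Context {R : realType} (tp : tensor_products R).

Local Notation "A ⊗ B" := (tp A B : cstarType R)
  (at level 40, left associativity) : type_scope.
Local Notation "a ⊗ b" := (mt_tens (tp _ _) a b)
  (at level 40, left associativity) : ring_scope.

Definition tensor_hom (A A' B B' : cstarType R) (f : A -> A') (g : B -> B')
    : (A ⊗ B)%type -> (A' ⊗ B')%type :=
  get [set F | star_hom F /\ forall a b, F (a ⊗ b) = f a ⊗ g b].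

(* id_A ⊗ Delta : A ⊗ H -> A ⊗ H ⊗ H, where A ⊗ H ⊗ H is bracketed as (A ⊗ H) ⊗ H:
   for z in H ⊗ H, the element "a ⊗ z" of (A ⊗ H) ⊗ H is the product of (a ⊗ 1) ⊗ 1
   with the image of z under h ⊗ k |-> (1 ⊗ h) ⊗ k. *)
Definition id_tensor_comul (H : cstarType R) (Delta : H -> (H ⊗ H)%type)
    (A : cstarType R) : (A ⊗ H)%type -> ((A ⊗ H) ⊗ H)%type :=
  get [set F : (A ⊗ H)%type -> ((A ⊗ H) ⊗ H)%type | star_hom F /\
    forall a h, F (a ⊗ h) =
      ((a ⊗ 1) ⊗ 1) * tensor_hom (fun k : H => (1 : A) ⊗ k) idfun (Delta h)].

(* A coaction of (H, Delta) on A: a coassociative unital *-homomorphism satisfying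
   the density (Podles) condition. *)
Definition coaction (H : cstarType R) (Delta : H -> (H ⊗ H)%type)
    (A : cstarType R) (delta : A -> (A ⊗ H)%type) : Prop :=
  [/\ star_hom delta,
      (forall a, tensor_hom delta idfun (delta a)
                 = id_tensor_comul Delta (delta a))
    & closure (lspan [set delta a * (1 ⊗ h) | a in setT & h in setT]) = setT].

Definition free_coaction (H : cstarType R) (Delta : H -> (H ⊗ H)%type)
    (A : cstarType R) (delta : A -> (A ⊗ H)%type) : Prop :=
  [/\ coaction Delta delta, injective delta
    & closure (lspan [set (a ⊗ 1) * delta b | a in setT & b in setT]) = setT].

(* Elements of C([0,1], A ⊗ H) are represented by functions on R, of which only
   the values on [0, 1] are used. *)
Definition equivariant_join (H A : cstarType R) (delta : A -> (A ⊗ H)%type)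
    : set (R -> (A ⊗ H)%type) :=
  [set f | [/\ {within `[0 : R, 1 : R], continuous f},
               range delta (f 0)
             & exists h : H, f 1 = 1 ⊗ h]].

(* A (Delta, delta_Delta)-equivariant unital *-homomorphism from H to the
   equivariant join.  The operations of the join are pointwise on [0, 1], and the
   two sides of delta_Delta (psi h) = (psi ⊗ id) (Delta h) are compared as
   functions on [0, 1] with values in A ⊗ H ⊗ H. *)
Definition equivariant_hom (H : cstarType R) (Delta : H -> (H ⊗ H)%type)
    (A : cstarType R) (delta : A -> (A ⊗ H)%type)
    (psi : H -> R -> (A ⊗ H)%type) : Prop :=
  [/\ (forall h, equivariant_join delta (psi h)),
      (forall t : R, t \in `[0, 1] -> star_hom (psi^~ t))
    & (forall h (t : R), t \in `[0, 1] ->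
         id_tensor_comul Delta (psi h t)
         = tensor_hom (psi^~ t) idfun (Delta h))].

Definition gc_comul (G : zmodType) (C : group_cstar R G) : C -> (C ⊗ C)%type :=
  gc_lift (fun g => gc_u C g ⊗ gc_u C g).

Definition amplification (B C : cstarType R) (sigma : C -> C)
    : C -> (B ⊗ C)%type :=
  fun a => 1 ⊗ sigma a.

(* An identification of H ⊕ H ⊕ H with H, given by its restrictions S 0, S 1, S 2
   to the three summands. *)
Definition triple_identification (B : cstarType R) (S : 'I_3 -> B) : Prop :=
  (forall i j, star (S i) * S j = (i == j)%:R) /\
  \sum_i S i * star (S i) = 1.

Definition direct_sum3 (B C : cstarType R) (S : 'I_3 -> B)
    (f0 f1 f2 : C -> (B ⊗ C)%type) : C -> (B ⊗ C)%type :=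
  fun a => let V i := S i ⊗ (1 : C) in
    V 0 * f0 a * star (V 0) + V 1 * f1 a * star (V 1)
    + V 2%:R * f2 a * star (V 2%:R).

Definition connected_representations (G : zmodType) (C : group_cstar R G)
    (H : hilbertType R) (B : bounded_operators H) : Prop :=
  infinite_dimensional H /\
  exists2 S : 'I_3 -> B, triple_identification S &
    hom_path (direct_sum3 S (amplification B (gc_id C))
                            (amplification B (gc_inv C))
                            (amplification B (gc_triv C)))
             (amplification B (gc_triv C)).

End Coactions.

Arguments gc_comul {R} tp {G} C _.

(* Main.v *)
(* Write [u x] for the canonical unitaries of [C = C^*(G)].  A path of unitary
   representations [w t : G -> B(H) ⊗ C] from [1 ⊗ u x] to the trivial representation gives
   the equivariant map [u x |-> (t |-> w t x ⊗ u x)]: at [t = 0] it is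
   [delta (1 ⊗ u x)], at [t = 1] it is [1 ⊗ u x].  Writing [n] for the representation
   [1 ⊗ u (n x)], the hypothesis is [1 + (-1) + 0 ~ 0], and a swindle based on
   [1 + 1 ≅ 1] and on multiplication by the central unitaries [1 ⊗ u (- x)] turns it into
   [1 ~ 0].

   For [id ⊗ Delta] to exist, [a ⊗ u x |-> (a ⊗ u x) ⊗ u x] must be bounded on finite
   sums.  Characters of [G] separate points, so averaging over them bounds each Fourier
   coefficient by the norm of the sum; hence the map is bounded on a given sum by the size
   of its support.  Supports of powers grow polynomially, so the C*-identity makes the
   map contractive. *)
Require Import Defs.
From HB Require Import structures.
From mathcomp Require Import all_boot all_order all_algebra.
From mathcomp Require Import complex zify ring.
From mathcomp Require Import all_classical all_reals all_analysis.

Set Implicit Arguments.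
Unset Strict Implicit.
Unset Printing Implicit Defensive.

Import Order.TTheory GRing.Theory Num.Theory.
Import numFieldNormedType.Exports.

Local Open Scope classical_set_scope.
Local Open Scope ring_scope.

(** Star-homomorphisms out of [C] come from its universal property, but those out of a tensor
    product are extended by density from finite sums of elementary tensors and need a norm estimate
    there. For [f ⊗ g] the estimate can be read off [mt_norm]. For [id ⊗ Delta] it cannot: [mt_norm]
    tests the target [(A ⊗ C) ⊗ C] against all representations of [A ⊗ C], not just those of product
    form. The detour through Fourier coefficients stands in for an associativity isomorphism of
    tensor products. In the swindle, direct sums are formed inside [B(H) ⊗ C] by means of isometries
    [t ⊗ 1], and an equivalence of representations is applied by conjugating a whole path with a
    unitary. A path ending at the trivial representation still ends there after conjugation, so the
    unitary itself never has to be joined to 1. *)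

Section LinearMaps.
Context {K : numFieldType} {U V : lmodType K} (f : U -> V).
Hypothesis f_lin : linear f.

Lemma linear_map0 : f 0 = 0.
Proof. by have := f_lin (-1) 0 0; rewrite !scaleN1r addr0 addNr oppr0 => ->. Qed.

Lemma linear_mapD x y : f (x + y) = f x + f y.
Proof. by have := f_lin 1 x y; rewrite !scale1r. Qed.

Lemma linear_mapZ k x : f (k *: x) = k *: f x.
Proof. by have := f_lin k x 0; rewrite linear_map0 !addr0. Qed.

Lemma linear_mapN x : f (- x) = - f x.
Proof. by rewrite -scaleN1r linear_mapZ scaleN1r. Qed.

Lemma linear_mapB x y : f (x - y) = f x - f y.
Proof. by rewrite linear_mapD linear_mapN. Qed.

Lemma linear_map_sum I (s : seq I) (P : pred I) (F : I -> U) :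
  f (\sum_(i <- s | P i) F i) = \sum_(i <- s | P i) f (F i).
Proof. exact: (big_morph f linear_mapD linear_map0). Qed.

End LinearMaps.

(** * Order and limits over the complex scalars *)

Section ComplexNorms.
Context {R : realType}.

(** The Archimedean property is taken from [R]: a positive [e] in [R[i]] is the image of its real
    part. *)
Lemma small_invS (e : R[i]) : 0 < e -> exists n, (n.+1%:R : R[i])^-1 < e.
Proof.
move=> e0; have eE : (complex.Re e)%:C%C = e by rewrite RRe_real// gtr0_real.
have e0' : 0 < complex.Re e by rewrite -ltcR eE.
exists (Num.truncn (complex.Re e)^-1).
rewrite -eE invf_plt ?posrE ?ltr0n ?ltcR//.
have -> : ((complex.Re e)%:C)%C^-1 = ((complex.Re e)^-1)%:C%C by rewrite [RHS]fmorphV.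
rewrite -[X in _ < X](rmorph_nat (real_complex R)) ltcR.
by rewrite truncnS_gt.
Qed.

Lemma le_of_le_addV (x y K : R[i]) : x \is Num.real -> y \is Num.real -> 0 <= K ->
  (forall n, x <= y + K / n.+1%:R) -> x <= y.
Proof.
move=> xr yr K0 le_xy; rewrite real_leNgt//; apply/negP => ltyx.
have K1 : 0 < K + 1 by rewrite ltr_wpDl.
have [|n] := @small_invS ((x - y) / (K + 1)); first by rewrite divr_gt0 ?subr_gt0.
rewrite ltr_pdivlMr// ltrBrDl => ltn.
have := lt_le_trans ltn (le_xy n); rewrite ltrD2l mulrC ltr_pM2r ?invr_gt0 ?ltr0n//.
by rewrite gtrDl ltr10.
Qed.

(** The fixed factor [K] lets later estimates collect several errors of size [e] without rescaling
    them. Realness is asked for because the order of [R[i]] is partial. *)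
Lemma le_of_small (x y K : R[i]) : x \is Num.real -> y \is Num.real -> 0 <= K ->
  (forall e, 0 < e -> e <= 1 -> x <= y + K * e) -> x <= y.
Proof.
move=> xr yr K0 le_xy; apply: (le_of_le_addV xr yr K0) => n.
by apply: le_xy; rewrite ?invr_gt0 ?ltr0n// invf_le1 ?ltr0n// ler1n.
Qed.

Lemma eq_of_small (V : normedModType R[i]) (x y : V) (K : R[i]) : 0 <= K ->
  (forall e, 0 < e -> e <= 1 -> `|x - y| <= K * e) -> x = y.
Proof.
move=> K0 xy; apply/eqP; rewrite -subr_eq0 -normr_le0.
by apply: (le_of_small _ _ K0) => // e e0 e1; rewrite add0r xy.
Qed.

Lemma small_expr (q e : R[i]) : 0 <= q -> q < 1 -> 0 < e -> exists n, q ^+ n < e.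
Proof.
move=> q0 q1 e0.
have eE : (complex.Re e)%:C%C = e by rewrite RRe_real// gtr0_real.
have qE : (complex.Re q)%:C%C = q by rewrite RRe_real// ger0_real.
rewrite -eE ltcR in e0; rewrite -qE ltcR in q1; rewrite -qE lecR in q0.
have /cvgrPdist_lt/(_ _ e0)[N _ /(_ N (leqnn N))] :=
  @cvg_geometric R 1 _ (eq_ind_r (fun z => z < 1) q1 (ger0_norm q0)).
rewrite /= mul1r sub0r normrN ger0_norm ?exprn_ge0// => qN.
by exists N; rewrite -qE -eE -rmorphXn ltcR.
Qed.

Lemma complete_seq (V : completeNormedModType R[i]) (u : nat -> V) :
  (forall e : R[i], 0 < e ->
    exists N, forall n, (N <= n)%N -> `|u N - u n| < e) -> cvgn u.
Proof.
move=> ucauchy; apply/cauchy_cvgP/cauchy_exP => e e0.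
have [N NP] := ucauchy e e0.
by exists (u N); exists N => // n /= /NP; rewrite -ball_normE.
Qed.

(** Cantor's intersection principle: [P e] collects the candidates at precision [e] and has diameter
    at most [K * e]. It serves to define the value of an extension at a point that is only
    approximated. *)
Lemma complete_nested (V : completeNormedModType R[i]) (P : R[i] -> set V) (K : R[i]) :
  0 <= K -> (forall e : R[i], 0 < e -> P e !=set0) ->
  (forall e e' : R[i], 0 < e -> e <= e' -> P e `<=` P e') ->
  (forall (e : R[i]) x y, 0 < e -> P e x -> P e y -> `|x - y| <= K * e) ->
  exists l, forall e : R[i], 0 < e -> exists2 y, P e y & `|l - y| < e.
Proof.
move=> K0 P0 Ple Pdist; have K1 : 0 < K + 1 by rewrite ltr_wpDl.
 pose r n : R[i] := n.+1%:R^-1.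
have r0 n : 0 < r n by rewrite invr_gt0 ltr0n.
have rle m n : (m <= n)%N -> r n <= r m.
  by move=> mn; rewrite lef_pV2 ?posrE ?ltr0n// ler_nat.
have /choice[u uP] n : exists y, P (r n) y by exact: P0.
have /cvg_ex[l /cvgrPdist_lt lu] : cvgn u; first apply: complete_seq.
  move=> e e0; have [|N Ne] := @small_invS (e / (K + 1)).
    by rewrite divr_gt0// ltr_wpDl.
  exists N => n Nn; apply: (@le_lt_trans _ _ (K * r N)).
    by apply: (Pdist _ _ _ (r0 N)) => //; exact: (Ple _ _ (r0 n) (rle _ _ Nn)).
  move: Ne; rewrite ltr_pdivlMr// mulrC => /le_lt_trans -> //.
  by rewrite ler_pM2r ?lerDl.
exists l => e e0; have [N _ NP] := lu e e0; have [M Me] := small_invS e0.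
exists (u (maxn N M)); last by apply: NP; exact: leq_maxl.
by apply: Ple (uP _); [exact: r0|rewrite (le_trans (rle _ _ (leq_maxr N M)))// ltW].
Qed.

End ComplexNorms.

(** * C*-algebras and their *-homomorphisms *)

Section CStarBasics.
Context {R : realType}.
Implicit Types A D : cstarType R.

Lemma star_linear A (k : R[i]) (a b : A) : star (k *: a + b) = k^* *: star a + star b.
Proof. exact: starP. Qed.

Lemma starD A (a b : A) : star (a + b) = star a + star b.
Proof. by have := starP 1 a b; rewrite !scale1r rmorph1 scale1r. Qed.

Lemma star0 A : star (0 : A) = 0.
Proof. by apply: (addIr (star (0 : A))); rewrite -starD !add0r. Qed.

Lemma starZ A (k : R[i]) (a : A) : star (k *: a) = k^* *: star a.
Proof. by have := starP k a 0; rewrite star0 !addr0. Qed.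

Lemma starN A (a : A) : star (- a) = - star a.
Proof. by rewrite -scaleN1r starZ rmorphN rmorph1 scaleN1r. Qed.

Lemma starB A (a b : A) : star (a - b) = star a - star b.
Proof. by rewrite starD starN. Qed.

Lemma star_sum A I (s : seq I) (P : pred I) (F : I -> A) :
  star (\sum_(i <- s | P i) F i) = \sum_(i <- s | P i) star (F i).
Proof. exact: (big_morph _ (@starD A) (star0 A)). Qed.

Lemma starMr A (a b : A) : star (a * b) = star b * star a.
Proof. exact: starM. Qed.

Lemma star1 A : star (1 : A) = 1.
Proof. by rewrite -[LHS]mulr1 -{2}[1](starK (1 : A)) -starMr mulr1 starK. Qed.

Lemma cnormM A (a b : A) : `|a * b| <= `|a| * `|b|.
Proof. exact: cstar_normM. Qed.

Lemma cnorm_starM A (a : A) : `|star a * a| = `|a| ^+ 2.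
Proof. exact: cstar_norm. Qed.

Lemma norm_star A (a : A) : `|star a| = `|a|.
Proof.
have le_star (b : A) : `|b| <= `|star b|.
  have [->|b0] := eqVneq b 0; first by rewrite normr0.
  have nb : 0 < `|b| by rewrite normr_gt0.
  by rewrite -(ler_pM2r nb) -expr2 -cnorm_starM cnormM.
apply/le_anti/andP; split; last exact: le_star.
by have := le_star (star a); rewrite starK.
Qed.

Lemma cnorm1 A : `|1 : A| = 1.
Proof.
have n1 : `|1 : A| != 0 by rewrite normr_eq0 oner_neq0.
by apply: (mulIf n1); rewrite -expr2 -cnorm_starM star1 mulr1 mul1r.
Qed.

Lemma norm_unitary A (u : A) : unitary u -> `|u| = 1.
Proof.
case=> uu _; have := cnorm_starM u; rewrite uu cnorm1 => /esym/eqP.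
by rewrite sqrp_eq1// => /eqP.
Qed.

End CStarBasics.

Section StarRelations.
Context {R : realType} {D : cstarType R}.
Implicit Types x a b : D.

Lemma star_mul0_sym a b : star a * b = 0 -> star b * a = 0.
Proof. by move=> ab; rewrite -[LHS]starK starMr starK ab star0. Qed.

(** The left factor [x] matches the left-associated words obtained by expanding products, so that a
    relation between isometries can act in the middle of a word. *)
Lemma mulr_star_eq1 x a b : star a * b = 1 -> x * star a * b = x.
Proof. by move=> ab; rewrite -mulrA ab mulr1. Qed.

Lemma mulr_star_eq0 x a b : star a * b = 0 -> x * star a * b = 0.
Proof. by move=> ab; rewrite -mulrA ab mulr0. Qed.

(** The Cuntz relations for two isometries: [T0] and [T1] are the two restrictions of a unitary from
    a direct sum of two copies onto one. *)
Definition double_isometry (T0 T1 : D) : Prop :=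
  [/\ star T0 * T0 = 1, star T1 * T1 = 1, star T0 * T1 = 0
    & T0 * star T0 + T1 * star T1 = 1].

End StarRelations.

Section StarHoms.
Context {R : realType} {A D : cstarType R} (f : A -> D).
Hypothesis fh : star_hom f.

Lemma star_hom_linear : linear f. Proof. by case: fh. Qed.
Lemma star_hom1 : f 1 = 1. Proof. by case: fh. Qed.
Lemma star_homM a b : f (a * b) = f a * f b. Proof. by case: fh. Qed.
Lemma star_hom_star a : f (star a) = star (f a). Proof. by case: fh. Qed.

Lemma star_hom_unitary u : unitary u -> unitary (f u).
Proof.
by case=> uu1 uu2; split; rewrite -star_hom_star -star_homM (uu1, uu2) star_hom1.
Qed.

End StarHoms.

Lemma star_hom_id {R : realType} (A : cstarType R) : star_hom (@idfun A).
Proof. by split. Qed.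

Lemma star_hom_comp {R : realType} (A D E : cstarType R) (f : A -> D) (g : D -> E) :
  star_hom f -> star_hom g -> star_hom (g \o f).
Proof.
move=> fh gh; split => [k a b||a b|a] /=.
- by rewrite (star_hom_linear fh) (star_hom_linear gh).
- by rewrite (star_hom1 fh) (star_hom1 gh).
- by rewrite (star_homM fh) (star_homM gh).
- by rewrite (star_hom_star fh) (star_hom_star gh).
Qed.

Section CStarLimits.
Context {R : realType} {A : cstarType R}.

Lemma cvg_cmul T (F : set_system T) (FF : Filter F) (f g : T -> A) (a b : A) :
  f @ F --> a -> g @ F --> b -> (fun x => f x * g x) @ F --> a * b.
Proof.
move=> fa gb; apply/cvgrPdist_le => e e0.
(* With [d = e / (e + K)], which is at most 1, the quadratic error [d * d] is at most [d]; the three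
   errors then add up to at most [d * K], hence to at most [e]. *)
pose K := 1 + `|a| + `|b|; have K0 : 0 < K by rewrite /K -addrA ltr_wpDr ?addr_ge0.
have eK : 0 < e + K by rewrite addr_gt0.
have d0 : 0 < e / (e + K) by rewrite divr_gt0.
have d1 : e / (e + K) <= 1 by rewrite ler_pdivrMr// mul1r lerDl ltW.
move/cvgrPdist_lt : fa => /(_ _ d0) fa; move/cvgrPdist_lt : gb => /(_ _ d0) gb.
near=> x.
have xa : `|a - f x| <= e / (e + K) by apply/ltW; near: x.
have xb : `|b - g x| <= e / (e + K) by apply/ltW; near: x.
have -> : a * b - f x * g x = a * (b - g x) + (a - f x) * b - (a - f x) * (b - g x).
  have {1}-> : f x = a - (a - f x) by rewrite subKr.
  have {1}-> : g x = b - (b - g x) by rewrite subKr.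
  by rewrite mulrBr !mulrBl !opprB addrC -addrA subrK addrAC.
rewrite (@le_trans _ _ (e / (e + K) * K))//; last first.
  by rewrite mulrAC ler_pdivrMr// ler_pM2l// lerDr ltW.
have -> : e / (e + K) * K = e / (e + K) * `|a| + e / (e + K) * `|b| + e / (e + K).
  by rewrite {2}/K !mulrDr mulr1 -!addrA [RHS]addrA [RHS]addrC.
rewrite (le_trans (ler_normB _ _))// lerD//.
  rewrite (le_trans (ler_normD _ _))// lerD// (le_trans (cnormM _ _))//.
    by rewrite mulrC ler_wpM2r.
  by rewrite ler_wpM2r.
rewrite (le_trans (cnormM _ _))// -[leRHS]mulr1.
by rewrite ler_pM// (le_trans xb).
Unshelve. all: by end_near. Qed.

Lemma cvg_star T (F : set_system T) (FF : Filter F) (f : T -> A) (a : A) :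
  f @ F --> a -> (fun x => star (f x)) @ F --> star a.
Proof.
move=> /cvgrPdist_lt fa; apply/cvgrPdist_lt => e e0; near=> x.
by rewrite -starB norm_star; near: x; exact: fa.
Unshelve. all: by end_near. Qed.

End CStarLimits.

Section Contractive.
Context {R : realType}.

(* Banach iteration for [y |-> (p + y^2)/2]; then [1 - y] is a square root of [1 - p]. *)
Lemma cstar_sqrt_one_sub (A : cstarType R) (p : A) : `|p| < 1 -> star p = p ->
  exists b : A, [/\ b * b = 1 - p, star b = b & forall a, a * p = p * a -> a * b = b * a].
Proof.
set q := `|p| => q1 sp; have q0 : 0 <= q by exact: normr_ge0.
pose h (y : A) := (2^-1 : R[i]) *: (p + y * y); pose u n := iter n h 0.
have half : `|2^-1 : R[i]| = 2^-1 by rewrite ger0_norm// invr_ge0.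
have hE (x : A) : (2^-1 : R[i]) *: x + (2^-1 : R[i]) *: x = x.
  by rewrite -scalerDl -[X in X + X]mul1r -splitr scale1r.
have halfE (x : R[i]) : 2^-1 * (x + x) = x by rewrite mulrDr mulrC -splitr.
have un n : `|u n| <= q.
  elim: n => [|n IH]; first by rewrite normr0.
  rewrite /= normrZ half -[leRHS]halfE ler_pM2l ?invr_gt0//.
  rewrite (le_trans (ler_normD _ _))// lerD// (le_trans (cnormM _ _))//.
  by rewrite (le_trans (ler_pM (normr_ge0 _) (normr_ge0 _) IH IH))// ler_piMl// ltW.
(* The difference of two squares is split without assuming that the iterates commute. Both have norm
   at most [q], so half of the two terms together contracts by the ratio [q]. *)
have du n : `|u n.+1 - u n| <= q ^+ n.
  elim: n => [|n IH]; first by rewrite subr0 expr0 (le_trans (un 1%N))// ltW.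
  have -> : u n.+2 - u n.+1 = (2^-1 : R[i]) *:
      ((u n.+1 - u n) * u n.+1 + u n * (u n.+1 - u n)).
    rewrite /= -/(u n) -/(u n.+1) {1 2}/h -scalerBr; congr (_ *: _).
    by rewrite opprD addrACA subrr add0r mulrBl mulrBr addrA subrK.
  rewrite normrZ half -[leRHS]halfE ler_pM2l ?invr_gt0//.
  rewrite (le_trans (ler_normD _ _))// exprSr lerD//.
    by rewrite (le_trans (cnormM _ _))// ler_pM.
  by rewrite (le_trans (cnormM _ _))// mulrC ler_pM.
have d0 : 0 < 1 - q by rewrite subr_gt0.
(* The geometric tail, multiplied by [1 - q] so that the sum telescopes. *)
have duk n k : (1 - q) * `|u n - u (n + k)%N| <= q ^+ n - q ^+ (n + k).
  elim: k => [|k IH]; first by rewrite addn0 !subrr normr0 mulr0.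
  rewrite addnS (le_trans (ler_wpM2l (ltW d0) (ler_distD (u (n + k)%N) _ _)))//.
  rewrite mulrDr -[leRHS](subrKA (q ^+ (n + k))) lerD//.
  rewrite distrC (le_trans (ler_wpM2l (ltW d0) (du _)))//.
  by rewrite mulrBl mul1r exprS.
have /cvg_ex[y uy] : cvgn u.
  apply: complete_seq => e e0; have [|N Ne] := small_expr q0 q1 (e := (1 - q) * e).
    by rewrite mulr_gt0.
  exists N => n Nn; rewrite -(ltr_pM2l d0) (le_lt_trans _ Ne)//.
  by rewrite -(subnKC Nn) (le_trans (duk _ _))// gerBl exprn_ge0.
have hy : h y = y.
  have uy1 : (fun n => u n.+1) @ \oo --> y by rewrite -(cvg_shiftS u) in uy.
  apply: (cvg_unique _ _ uy1) => //=.
  by apply: cvgZr; apply: cvgD; [exact: cvg_cst|exact: cvg_cmul].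
have sy : star y = y.
  apply: (cvg_unique _ (cvg_star _ uy)) => //=.
  have -> : (fun n => star (u n)) = u; last by [].
  apply/funext; elim=> [|n IH]; first exact: star0.
  by rewrite /= starZ starD starMr IH sp fmorphV rmorph_nat.
exists (1 - y); split => [||a ap].
- have yy : y + y = p + y * y by rewrite -{1 2}hy hE.
  by rewrite mulrBr mulr1 mulrBl mul1r -addrA -opprD addrA yy addrK.
- by rewrite starB star1 sy.
- rewrite mulrBr mulrBl mulr1 mul1r; congr (_ - _).
  have ay : (fun n => a * u n) @ \oo --> a * y by apply: cvg_cmul => //; exact: cvg_cst.
  apply: (cvg_unique _ ay) => //=.
  have -> : (fun n => a * u n) = (fun n => u n * a); last first.
    by apply: cvg_cmul => //; exact: cvg_cst.
  apply/funext; elim=> [|n IH]; first by rewrite mulr0 mul0r.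
  rewrite /= /h -scalerAr -scalerAl mulrDr mulrDl ap; congr (_ *: (_ + _)).
  by rewrite mulrA IH -mulrA IH mulrA.
Qed.

(* A selfadjoint [a] of norm [< 1] is the real part of the unitary
   [a + i sqrt (1 - a^2)], and unitaries are sent to unitaries. *)
Lemma star_hom_contractive (A D : cstarType R) (f : A -> D) : star_hom f ->
  forall a, `|f a| <= `|a|.
Proof.
move=> fh; have fl := star_hom_linear fh.
have sa1 a : star a = a -> `|a| < 1 -> `|f a| <= 1.
  move=> sa a1; have [||b [bb sb ab]] := @cstar_sqrt_one_sub A (a * a).
  - by rewrite -{1}sa cnorm_starM expr_lt1.
  - by rewrite starMr sa.
  have {}ab := ab a (mulrA _ _ _).
  have si : star ('i *: b) = - ('i *: b) by rewrite starZ conjCi scaleNr sb.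
  have uu : unitary (a + 'i *: b).
    have i2 : ('i *: b) * ('i *: b) = - (1 - a * a).
      by rewrite -scalerAl -scalerAr scalerA -expr2 sqrCi bb scaleN1r.
    have iab : a * ('i *: b) = 'i *: b * a by rewrite -scalerAr -scalerAl ab.
    split; rewrite starD sa si.
      by rewrite mulrDr !mulrBl iab addrA subrK i2 opprK addrC subrK.
    by rewrite mulrBr !mulrDl iab opprD addrA addrK i2 opprK addrC subrK.
  have fu := norm_unitary (star_hom_unitary fh uu).
  have -> : f a = (2^-1 : R[i]) *: (f (a + 'i *: b) + star (f (a + 'i *: b))).
    rewrite -(star_hom_star fh) -(linear_mapD fl) starD sa si addrACA subrr addr0.
    by rewrite (linear_mapD fl) scalerDr -scalerDl -[2^-1]mul1r -splitr scale1r.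
  rewrite normrZ ger0_norm ?invr_ge0// ler_pdivrMl// mulr1.
  by rewrite (le_trans (ler_normD _ _))// norm_star fu.
(* Dividing by [|a| + e] rather than by [|a|] gives the strict inequality required above and also
   covers [a = 0]. *)
have sa2 a : star a = a -> `|f a| <= `|a|.
  move=> sa; apply: (@le_of_small _ _ _ 1) => // e e0 _; rewrite mul1r.
  have r0 : 0 < `|a| + e by rewrite ltr_wpDl.
  have := sa1 ((`|a| + e)^-1 *: a); rewrite (linear_mapZ fl) !normrZ.
  rewrite gtr0_norm ?invr_gt0// starZ sa !ler_pdivrMl// !ltr_pdivrMl// !mulr1.
  apply; last by rewrite ltrDl.
  by congr (_ *: _); apply/CrealP; rewrite gtr0_real// invr_gt0.
move=> a; suff: `|f a| ^+ 2 <= `|a| ^+ 2 by rewrite ler_pXn2r ?nnegrE.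
rewrite -!cnorm_starM -(star_hom_star fh) -(star_homM fh).
by apply: sa2; rewrite starMr starK.
Qed.

End Contractive.

(** * Closed spans and extension by density *)

Section ClosedSpan.
Context {R : realType}.
Implicit Types V W : normedModType R[i].

Definition cspan V (S : set V) : set V := closure (lspan S).

Lemma closure_approx V (S : set V) x :
  closure S x <-> forall e : R[i], 0 < e -> exists2 y, S y & `|x - y| < e.
Proof.
split=> [Sx e e0|Sx B /nbhs_ballP[e e0 eB]].
  have [y [Sy]] := Sx _ (nbhsx_ballx x e e0).
  by rewrite -ball_normE => xy; exists y.
have [y Sy xy] := Sx e e0.
by exists y; split => //; apply: eB; rewrite -ball_normE.
Qed.

Lemma lspanP V (S : set V) k x y : lspan S x -> lspan S y -> lspan S (k *: x + y).
Proof.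
case=> s sS -> [t tS ->].
exists ([seq (k * p.1, p.2) | p <- s] ++ t).
  move=> p; rewrite mem_cat => /orP[/mapP[q /sS Sq ->]//|/tS//].
rewrite big_cat big_map scaler_sumr /=; congr (_ + _).
by apply: eq_bigr => p _; rewrite scalerA.
Qed.

Lemma lspan_gen V (S : set V) x : S x -> lspan S x.
Proof.
move=> Sx; exists [:: (1, x)]; first by move=> p; rewrite inE => /eqP ->.
by rewrite big_seq1 scale1r.
Qed.

Lemma lspan0 V (S : set V) : lspan S 0.
Proof. by exists [::]; rewrite ?big_nil. Qed.

Lemma lspan_sub_submod V (S P : set V) :
  P 0 -> (forall k x y, P x -> P y -> P (k *: x + y)) -> S `<=` P -> lspan S `<=` P.
Proof.
move=> P0 PP SP _ [s sS ->]; elim: s sS => [|p s IH] sS; first by rewrite big_nil.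
rewrite big_cons; apply: PP; first by apply/SP/sS; rewrite mem_head.
by apply: IH => q qs; apply: sS; rewrite inE qs orbT.
Qed.

Lemma sub_cspan V (S : set V) : S `<=` cspan S.
Proof. by move=> x /lspan_gen; exact: subset_closure. Qed.

Lemma cspan0 V (S : set V) : cspan S 0.
Proof. by apply: subset_closure; exact: lspan0. Qed.

Lemma cspanP V (S : set V) k x y : cspan S x -> cspan S y -> cspan S (k *: x + y).
Proof.
move=> /closure_approx Sx /closure_approx Sy; apply/closure_approx => e e0.
have k1 : 0 < `|k| + 1 by rewrite ltr_wpDl.
have d0 : 0 < e / (2 * (`|k| + 1)) by rewrite divr_gt0// mulr_gt0.
have [x' Sx' xx'] := Sx _ d0; have [y' Sy' yy'] := Sy _ (divr_gt0 e0 (ltr0Sn _ 1)).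
exists (k *: x' + y'); first exact: lspanP.
rewrite opprD addrACA -scalerBr (le_lt_trans (ler_normD _ _))//.
rewrite [ltRHS]splitr ler_ltD// normrZ (le_trans (ler_wpM2l _ (ltW xx')))//.
rewrite invfM mulrA mulrCA [leRHS]mulrC -[leRHS]mulr1 [_ * e]mulrC -mulrA.
by rewrite ?mulrA [_^-1 * e]mulrC -mulrA ler_pM2l ?divr_gt0// ler_pdivrMr// mul1r lerDl.
Qed.

Lemma cspan_closed V (S : set V) x :
  (forall e : R[i], 0 < e -> exists2 y, cspan S y & `|x - y| < e) -> cspan S x.
Proof.
by move=> /closure_approx; rewrite -(closure_id _).1//; exact: closed_closure.
Qed.

Lemma cspan_sub V (S T : set V) : S `<=` cspan T -> cspan S `<=` cspan T.
Proof.
move=> ST x /closure_approx Sx; apply: cspan_closed => e e0.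
have [y Sy xy] := Sx e e0; exists y => //.
by apply: lspan_sub_submod ST _ Sy; [exact: cspan0|move=> *; exact: cspanP].
Qed.

Lemma cspan_image V W (f : V -> W) (S : set V) (T : set W) (K : R[i]) :
  linear f -> (forall x, `|f x| <= K * `|x|) -> 0 <= K ->
  (forall x, S x -> cspan T (f x)) -> forall x, cspan S x -> cspan T (f x).
Proof.
move=> fl fK K0 ST x /closure_approx Sx; apply: cspan_closed => e e0.
have K1 : 0 < K + 1 by rewrite ltr_wpDl.
have [|y Sy xy] := Sx (e / (K + 1)); first by rewrite divr_gt0.
exists (f y); last first.
  rewrite -(linear_mapB fl) (le_lt_trans (fK _))// (@le_lt_trans _ _ ((K + 1) * `|x - y|))//.
    by rewrite ler_wpM2r// lerDl.
  by rewrite -ltr_pdivlMl// mulrC.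
apply: (@lspan_sub_submod _ S (fun y => cspan T (f y))) Sy => //.
  by rewrite (linear_map0 fl); exact: cspan0.
by move=> k u v Tu Tv; rewrite fl; exact: cspanP.
Qed.

Lemma dense_eq V W (f g : V -> W) (S : set V) (K : R[i]) : linear f -> linear g ->
  (forall x, `|f x| <= K * `|x|) -> (forall x, `|g x| <= K * `|x|) -> 0 <= K ->
  cspan S = setT -> (forall x, S x -> f x = g x) -> f =1 g.
Proof.
move=> fl gl fK gK K0 ST fg x; apply: (@eq_of_small _ _ _ _ (K + K)) => [|e e0 _].
  by rewrite addr_ge0.
have /closure_approx/(_ _ e0)[y Sy xy] : cspan S x by rewrite ST.
have fgy : f y = g y.
  apply: (@lspan_sub_submod _ S (fun y => f y = g y)) Sy => //.
    by rewrite (linear_map0 fl) (linear_map0 gl).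
  by move=> k u v fgu fgv; rewrite fl gl fgu fgv.
rewrite -(subrKA (f y)) {2}fgy -[g y - _]opprB -(linear_mapB fl) -(linear_mapB gl).
rewrite (le_trans (ler_normB _ _))// mulrDl lerD//.
  by rewrite (le_trans (fK _))// ler_wpM2l// ltW.
by rewrite (le_trans (gK _))// ler_wpM2l// ltW.
Qed.

End ClosedSpan.

Section Extension.
Context {R : realType}.

(* The graph of the extension is the closure of the graph on finite combinations. *)
Lemma extend_contraction (V : normedModType R[i]) (W : completeNormedModType R[i])
    (I : Type) (e : I -> V) (T : I -> W) :
  (forall s : seq (R[i] * I),
     `|\sum_(p <- s) p.1 *: T p.2| <= `|\sum_(p <- s) p.1 *: e p.2|) ->
  cspan (range e) = setT ->
  exists F : V -> W, [/\ linear F, (forall x, `|F x| <= `|x|) & forall i, F (e i) = T i].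
Proof.
move=> bnd dense; pose te s := \sum_(p <- s) p.1 *: e p.2.
pose tT (s : seq (R[i] * I)) := \sum_(p <- s) p.1 *: T p.2.
(* The hypothesis applied to the formal difference of [s] and [t]: the value depends only on [te s],
   and close sums have close values. *)
have dist s t : `|tT s - tT t| <= `|te s - te t|.
  have nE (U : lmodType R[i]) (h : I -> U) :
      \sum_(p <- t) (- p.1) *: h p.2 = - \sum_(p <- t) p.1 *: h p.2.
    by rewrite -sumrN; apply: eq_bigr => p _; rewrite scaleNr.
  by have := bnd (s ++ [seq (- p.1, p.2) | p <- t]); rewrite !big_cat !big_map /= !nE.
have lspan_te y : lspan (range e) y -> exists s, y = te s.
  apply: (@lspan_sub_submod _ _ _ (fun y => exists s, y = te s)).
  - by exists [::]; rewrite /te big_nil.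
  - move=> k _ _ [s ->] [t ->]; exists ([seq (k * p.1, p.2) | p <- s] ++ t).
    rewrite /te big_cat big_map scaler_sumr /=; congr (_ + _).
    by apply: eq_bigr => p _; rewrite scalerA.
  - by move=> _ [i _ <-]; exists [:: (1, i)]; rewrite /te big_seq1 scale1r.
pose P x (d : R[i]) := [set y | exists2 s, `|x - te s| < d & y = tT s].
have /choice[F FP] x : exists l, forall d : R[i], 0 < d ->
    exists2 s, `|x - te s| < d & `|l - tT s| < d.
  have [||||l lP] := @complete_nested R W (P x) 2 => //.
  - move=> d d0; have /closure_approx/(_ _ d0)[y /lspan_te[s ->] xs] :
      cspan (range e) x by rewrite dense.
    by exists (tT s); exists s.
  - by move=> d d' _ dd' y [s xs ->]; exists s => //; exact: lt_le_trans dd'.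
  - move=> d _ _ d0 [s xs ->] [t xt ->]; rewrite (le_trans (dist _ _))//.
    rewrite (le_trans (ler_distD x _ _))// mulr_natl mulr2n lerD//.
      by rewrite distrC ltW.
    by rewrite ltW.
  - exists l => d d0; have [|_ [s xs ->] ls] := lP (d / 2); first by rewrite divr_gt0.
    have d2 : d / 2 <= d by rewrite ler_pdivrMr// ler_peMr ?ltW// ltr1n.
    by exists s; exact: lt_le_trans d2.
exists F; split.
- move=> k x y; apply: (@eq_of_small _ _ _ _ (2 * (2 + `|k|))) => [|d d0 _].
    by rewrite mulr_ge0// addr_ge0.
  have [s1 zs1 Fs1] := FP (k *: x + y) d d0; have [s2 xs2 Fs2] := FP x d d0.
  have [s3 ys3 Fs3] := FP y d d0.
  pose s4 := [seq (k * p.1, p.2) | p <- s2] ++ s3.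
  have teE : te s4 = k *: te s2 + te s3.
    rewrite /te big_cat big_map scaler_sumr /=; congr (_ + _).
    by apply: eq_bigr => p _; rewrite scalerA.
  have tTE : tT s4 = k *: tT s2 + tT s3.
    rewrite /tT big_cat big_map scaler_sumr /=; congr (_ + _).
    by apply: eq_bigr => p _; rewrite scalerA.
  have comb (U : normedModType R[i]) (u u' v v' : U) : `|u - u'| < d -> `|v - v'| < d ->
      `|k *: u + v - (k *: u' + v')| <= (1 + `|k|) * d.
    move=> uu vv; rewrite opprD addrACA -scalerBr (le_trans (ler_normD _ _))//.
    rewrite mulrDl mul1r [leRHS]addrC lerD ?(ltW vv)// normrZ.
    by rewrite ler_wpM2l// ltW.
  have h1 : `|tT s1 - tT s4| <= d + (1 + `|k|) * d.
    rewrite (le_trans (dist _ _))// (le_trans (ler_distD (k *: x + y) _ _))//.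
    by rewrite lerD ?teE ?comb// distrC ltW.
  rewrite (le_trans (ler_distD (tT s1) _ _))// mulr_natl mulr2n mulrDl.
  have -> : (2 + `|k|) * d + (2 + `|k|) * d = d + ((d + (1 + `|k|) * d) + (1 + `|k|) * d).
    by ring.
  rewrite lerD ?(ltW Fs1)// (le_trans (ler_distD (tT s4) _ _))// lerD//.
  by rewrite distrC tTE comb.
- move=> x; apply: (@le_of_small _ _ _ 2) => // d d0 _.
  have [s xs Fs] := FP x d d0.
  rewrite -[F x](subrK (tT s)) (le_trans (ler_normD _ _))// mulr_natl mulr2n addrCA addrC.
  rewrite addrC lerD ?(ltW Fs)// (le_trans (bnd _))// -/(te s).
  rewrite -[te s](subrK x) (le_trans (ler_normD _ _))// addrC lerD//.
  by rewrite distrC ltW.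
- move=> i; apply: (@eq_of_small _ _ _ _ 2) => // d d0 _.
  have [s xs Fs] := FP (e i) d d0.
  rewrite (le_trans (ler_distD (tT s) _ _))// mulr_natl mulr2n lerD ?(ltW Fs)//.
  have := dist s [:: (1, i)]; rewrite /te /tT !big_seq1 !scale1r => /le_trans -> //.
  by rewrite distrC ltW.
Qed.

(** The operations [m], [st] and [one] lift product, adjoint and unit to indices, so that each
    algebraic identity is checked on generators and then passes to the closure. *)
Lemma extend_star_hom (A D : cstarType R) (I : Type) (e : I -> A) (T : I -> D)
    (m : I -> I -> I) (st : I -> I) (one : I) :
  (forall s : seq (R[i] * I),
     `|\sum_(p <- s) p.1 *: T p.2| <= `|\sum_(p <- s) p.1 *: e p.2|) ->
  cspan (range e) = setT ->
  e one = 1 -> T one = 1 ->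
  (forall i j, e (m i j) = e i * e j) -> (forall i j, T (m i j) = T i * T j) ->
  (forall i, e (st i) = star (e i)) -> (forall i, T (st i) = star (T i)) ->
  exists F : A -> D, star_hom F /\ forall i, F (e i) = T i.
Proof.
move=> bnd dense e1 T1 eM TM eS TS.
have [F [Fl Fc Fe]] := extend_contraction bnd dense.
have Fc1 x : `|F x| <= 1 * `|x| by rewrite mul1r.
exists F; split=> //; split => //.
- by rewrite -e1 Fe.
(* Density is used in one variable at a time: first on the left with a generator on the right, then
   on the right. *)
- have FMr i x : F (x * e i) = F x * F (e i).
    pose K := `|e i| + `|F (e i)|.
    have lin1 : linear (fun x => F (x * e i)).
      by move=> k u v; rewrite mulrDl -scalerAl Fl.
    have lin2 : linear (fun x => F x * F (e i)).
      by move=> k u v; rewrite Fl mulrDl -scalerAl.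
    apply: (@dense_eq _ _ _ _ _ (range e) K lin1 lin2) => //.
    + move=> y; rewrite (le_trans (Fc _))// (le_trans (cnormM _ _))// mulrC.
      by rewrite ler_wpM2r// lerDl.
    + move=> y; rewrite (le_trans (cnormM _ _))// mulrC ler_pM// lerDr//.
    + by rewrite addr_ge0.
    + by move=> _ [j _ <-]; rewrite -eM !Fe TM.
  move=> a b; pose K := `|a| + `|F a|.
  have lin1 : linear (fun x => F (a * x)).
    by move=> k u v; rewrite mulrDr -scalerAr Fl.
  have lin2 : linear (fun x => F a * F x).
    by move=> k u v; rewrite Fl mulrDr -scalerAr.
  apply: (@dense_eq _ _ _ _ _ (range e) K lin1 lin2) => //.
  + move=> y; rewrite (le_trans (Fc _))// (le_trans (cnormM _ _))//.
    by rewrite ler_wpM2r// lerDl.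
  + by move=> y; rewrite (le_trans (cnormM _ _))// ler_pM// lerDr.
  + by rewrite addr_ge0.
  + by move=> _ [j _ <-]; exact: FMr.
- move=> a; rewrite -[F (star a)]starK; congr star.
  have lin1 : linear (fun x => star (F (star x))).
    by move=> k u v; rewrite star_linear Fl star_linear conjCK.
  apply: (@dense_eq _ _ _ _ _ (range e) 1 lin1 Fl) => //.
  + by move=> y; rewrite norm_star mul1r (le_trans (Fc _))// norm_star.
  + by move=> _ [j _ <-]; rewrite -eS !Fe TS starK.
Qed.

End Extension.

(** * Group C*-algebras *)

(** Density of the span of the canonical unitaries comes from the universal property with that
    closed span as target, so the closed span must be a C*-algebra in its own right. *)
Record closed_star_subalgebra (R : realType) (A : cstarType R) := ClosedStarSubalgebra {
  csa_set : set A ;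
  csa1 : csa_set 1 ;
  csaP : forall (k : R[i]) x y, csa_set x -> csa_set y -> csa_set (k *: x + y) ;
  csaM : forall x y, csa_set x -> csa_set y -> csa_set (x * y) ;
  csa_star : forall x, csa_set x -> csa_set (star x) ;
  csa_closed : closed csa_set
}.

(** Membership is made boolean so that two elements are equal as soon as their underlying values
    are. *)
Definition csa_type (R : realType) (A : cstarType R) (E : closed_star_subalgebra A) :=
  {x : A | `[< csa_set E x >]}.

Section ClosedStarSubalgebra.
Context {R : realType} {A : cstarType R} (E : closed_star_subalgebra A).
Local Notation T := (csa_type E).

Let inE (x : T) : csa_set E (sval x). Proof. by apply/asboolP; exact: (svalP x). Qed.

Let E0 : csa_set E 0.
Proof. by rewrite -(addNr 1) -scaleN1r; apply: csaP; exact: csa1. Qed.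

Let ED x y : csa_set E x -> csa_set E y -> csa_set E (x + y).
Proof. by move=> Ex Ey; rewrite -[x]scale1r; exact: csaP. Qed.

Let EZ k x : csa_set E x -> csa_set E (k *: x).
Proof. by move=> Ex; rewrite -[_ *: _]addr0; exact: csaP. Qed.

Let EN x : csa_set E x -> csa_set E (- x).
Proof. by rewrite -scaleN1r; exact: EZ. Qed.

Definition csa_pack (x : A) (Ex : csa_set E x) : T := exist _ x (asboolT Ex).

Let add (x y : T) : T := csa_pack (ED (inE x) (inE y)).
Let opp (x : T) : T := csa_pack (EN (inE x)).
Let scale (k : R[i]) (x : T) : T := csa_pack (EZ k (inE x)).
Let mul (x y : T) : T := csa_pack (csaM (inE x) (inE y)).
Let st (x : T) : T := csa_pack (csa_star (inE x)).

Let sval_eq (x y : T) : sval x = sval y -> x = y.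
Proof. exact: val_inj. Qed.

HB.instance Definition _ := Choice.on T.

Let addA : associative add.
Proof. by move=> x y z; apply: sval_eq; exact: addrA. Qed.
Let addC : commutative add.
Proof. by move=> x y; apply: sval_eq; exact: addrC. Qed.
Let add0 : left_id (csa_pack E0) add.
Proof. by move=> x; apply: sval_eq; exact: add0r. Qed.
Let addN : left_inverse (csa_pack E0) opp add.
Proof. by move=> x; apply: sval_eq; exact: addNr. Qed.

HB.instance Definition _ := GRing.isZmodule.Build T addA addC add0 addN.

Let scaleA a b v : scale a (scale b v) = scale (a * b) v.
Proof. by apply: sval_eq; exact: scalerA. Qed.
Let scale1 : left_id 1 scale.
Proof. by move=> x; apply: sval_eq; exact: scale1r. Qed.
Let scaleDr : right_distributive scale +%R.
Proof. by move=> k x y; apply: sval_eq; exact: scalerDr. Qed.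
Let scaleDl v : {morph scale^~ v : a b / a + b}.
Proof. by move=> a b; apply: sval_eq; exact: scalerDl. Qed.

HB.instance Definition _ :=
  GRing.Zmodule_isLmodule.Build R[i] T scaleA scale1 scaleDr scaleDl.

Let nrm (x : T) : R[i] := `|sval x|.
Let nrmD x y : nrm (x + y) <= nrm x + nrm y. Proof. exact: ler_normD. Qed.
Let nrmZ k x : nrm (k *: x) = `|k| * nrm x. Proof. exact: normrZ. Qed.
Let nrm0 x : nrm x = 0 -> x = 0.
Proof. by move=> /normr0_eq0 x0; exact: sval_eq. Qed.

HB.instance Definition _ := Lmodule_isNormed.Build R[i] T nrmD nrmZ nrm0.

Let T_complete (F : set_system T) : ProperFilter F -> cauchy F -> cvg F.
Proof.
move=> FF /cauchyP cF.
have /cauchy_cvgP/cvg_ex[l Fl] : cauchy (sval @ F).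
  apply: cauchy_exP => e e0; have [x Fx] := cF e e0; exists (sval x).
  by rewrite /fmap /=; move: Fx; apply: filterS => y; rewrite -!ball_normE.
have El : csa_set E l.
  apply: (csa_closed (c := E)) => B /Fl FB.
  by have [y yB] := filter_ex (FB : F _); exists (sval y); split.
apply/cvg_ex; exists (csa_pack El); apply/cvgrPdist_lt => e e0.
by move/cvgrPdist_lt : Fl => /(_ e e0).
Qed.

HB.instance Definition _ := Uniform_isComplete.Build T T_complete.

Let mulA : associative mul.
Proof. by move=> x y z; apply: sval_eq; exact: mulrA. Qed.
Let mul1l : left_id (csa_pack (csa1 E)) mul.
Proof. by move=> x; apply: sval_eq; exact: mul1r. Qed.
Let mul1r : right_id (csa_pack (csa1 E)) mul.
Proof. by move=> x; apply: sval_eq; exact: mulr1. Qed.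
Let mulDl : left_distributive mul +%R.
Proof. by move=> x y z; apply: sval_eq; exact: mulrDl. Qed.
Let mulDr : right_distributive mul +%R.
Proof. by move=> x y z; apply: sval_eq; exact: mulrDr. Qed.
Let one_neq0 : csa_pack (csa1 E) != 0.
Proof. by apply/eqP => /(congr1 sval)/eqP; rewrite oner_eq0. Qed.
Let scaleAl k a b : k *: mul a b = mul (k *: a) b.
Proof. by apply: sval_eq; exact: scalerAl. Qed.
Let scaleAr k a b : k *: mul a b = mul a (k *: b).
Proof. by apply: sval_eq; exact: scalerAr. Qed.
Let stK : involutive st.
Proof. by move=> x; apply: sval_eq; exact: starK. Qed.
Let stP k a b : st (k *: a + b) = k^* *: st a + st b.
Proof. by apply: sval_eq; exact: starP. Qed.
Let stM a b : st (mul a b) = mul (st b) (st a).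
Proof. by apply: sval_eq; exact: starM. Qed.
Let normM a b : `|mul a b| <= `|a| * `|b|. Proof. exact: cnormM. Qed.
Let norm_st a : `|mul (st a) a| = `|a| ^+ 2. Proof. exact: cnorm_starM. Qed.

HB.instance Definition _ := isCStarAlgebra.Build R T mulA mul1l mul1r mulDl mulDr
  one_neq0 scaleAl scaleAr stK stP stM normM norm_st.

Lemma csa_val_star_hom : star_hom (sval : T -> A).
Proof. by []. Qed.

End ClosedStarSubalgebra.

Section GroupCStarTheory.
Context {R : realType} {G : zmodType} (C : group_cstar R G).

Local Notation u := (gc_u C).

Lemma gc_hom_ext (D : cstarType R) (f g : C -> D) : star_hom f -> star_hom g ->
  (forall x, f (u x) = g (u x)) -> f = g.
Proof.
move=> fh gh fg; have [uu uM] := gc_unitary C.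
have [|h [_ hU]] := @gc_universal R G C D (fun x => f (u x)).
  split=> [x|x y]; first exact: star_hom_unitary.
  by rewrite uM (star_homM fh).
transitivity h; first by apply/esym/hU.
by apply: hU; split=> // x; rewrite fg.
Qed.

Lemma gc_liftP (D : cstarType R) (v : G -> D) : unitary_representation v ->
  star_hom (@gc_lift _ _ C D v) /\ forall x, gc_lift v (u x) = v x.
Proof.
move=> vr; have [f [fP _]] := @gc_universal R G C D v vr.
by rewrite /gc_lift; case: xgetP => [h _ hP|/(_ f)//].
Qed.

Lemma unitary_rep0 (D : cstarType R) (v : G -> D) : unitary_representation v -> v 0 = 1.
Proof.
move=> [vu vM]; have [v1 _] := vu 0.
by rewrite -[LHS]mul1r -v1 -mulrA -vM addr0.
Qed.

Lemma unitary_repN (D : cstarType R) (v : G -> D) x : unitary_representation v ->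
  v (- x) = star (v x).
Proof.
move=> vr; have [vu vM] := vr; have [v1 _] := vu x.
by rewrite -[LHS]mul1r -v1 -mulrA -vM subrr (unitary_rep0 vr) mulr1.
Qed.

(* By universality, [C] retracts onto the closed span of its canonical unitaries. *)
Lemma gc_dense : cspan (range u) = setT.
Proof.
have ur := gc_unitary C; have [uu uM] := ur.
pose E := cspan (range u).
have uE x : E (u x) by apply: sub_cspan; exists x.
have ZlinM (x : C) : linear (fun y => x * y).
  by move=> k a b; rewrite mulrDr -scalerAr.
have ZrinM (x : C) : linear (fun y => y * x).
  by move=> k a b; rewrite mulrDl -scalerAl.
have EMu x y : E x -> E (x * u y).
  apply: (cspan_image (ZrinM (u y)) (K := `|u y|)) => // [z|_ [z _ <-]].
    by rewrite mulrC cnormM.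
  by rewrite -uM; exact: uE.
have EM x y : E x -> E y -> E (x * y).
  move=> Ex; apply: (cspan_image (ZlinM x) (K := `|x|)) => // [z|_ [z _ <-]].
    by rewrite cnormM.
  by apply: EMu; exact: Ex.
have Est x : E x -> E (star x).
  move=> /closure_approx Sx; apply: cspan_closed => e e0; have [y Sy xy] := Sx e e0.
  exists (star y); last by rewrite -starB norm_star.
  apply: (@lspan_sub_submod _ _ _ (fun y => E (star y))) Sy => //.
  - by rewrite star0; exact: cspan0.
  - by move=> k a b Ea Eb; rewrite star_linear; exact: cspanP.
  - by move=> _ [z _ <-]; rewrite -(unitary_repN _ ur).
have E1 : E 1 by rewrite -(unitary_rep0 ur).
pose EE := @ClosedStarSubalgebra R C E E1 (@cspanP _ _ _) EM Est (@closed_closure _ _).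
have vr : unitary_representation (fun x => csa_pack (E := EE) (uE x)).
  split=> [x|x y]; last by apply: val_inj; exact: uM.
  by have [ux1 ux2] := uu x; split; apply: val_inj.
have [fh fu] := gc_liftP vr.
have := gc_hom_ext (star_hom_comp fh (csa_val_star_hom EE)) (star_hom_id C).
move=> H.
have {}H x : sval (@gc_lift _ _ C (csa_type EE) (fun x => csa_pack (E := EE) (uE x)) x) = x.
  by have := congr1 (@^~ x) (H (fun y => congr1 sval (fu y))).
apply/seteqP; split=> // x _; rewrite -(H x).
by case: (gc_lift _ x) => y /= /asboolP.
Qed.

End GroupCStarTheory.

(** * Minimal tensor products *)

Lemma representation_comp {R : realType} (A D : cstarType R) (H : hilbertType R)
    (f : A -> D) (pi : D -> H -> H) :
  star_hom f -> representation pi -> representation (fun a => pi (f a)).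
Proof.
move=> fh [piB [piP pi1 piM piS]]; split=> [a|]; first exact: piB.
split=> [k a b x|x|a b x|a x y].
- by rewrite (star_hom_linear fh) piP.
- by rewrite (star_hom1 fh) pi1.
- by rewrite (star_homM fh) piM.
- by rewrite piS (star_hom_star fh).
Qed.

Section MinTensor.
Context {R : realType} {A B : cstarType R} (M : min_tensor A B).
Local Notation "a ⊗ b" := (mt_tens M a b) (at level 40, left associativity).

Lemma tensZl k a b : (k *: a) ⊗ b = k *: (a ⊗ b).
Proof. exact: (linear_mapZ (mt_linl M b)). Qed.

Lemma tensZr k a b : a ⊗ (k *: b) = k *: (a ⊗ b).
Proof. exact: (linear_mapZ (mt_linr M a)). Qed.

Lemma tens_split a b : a ⊗ b = (a ⊗ 1) * (1 ⊗ b).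
Proof. by rewrite -mt_M mulr1 mul1r. Qed.

Lemma tens_comm a b : (a ⊗ 1) * (1 ⊗ b) = (1 ⊗ b) * (a ⊗ 1).
Proof. by rewrite -!mt_M !mulr1 !mul1r. Qed.

Lemma star_hom_tensl : star_hom (fun a => a ⊗ 1).
Proof.
split => [||a a'|a]; first exact: mt_linl.
- exact: mt_1.
- by rewrite -mt_M mulr1.
- by rewrite -mt_star star1.
Qed.

Lemma star_hom_tensr : star_hom (fun b => 1 ⊗ b).
Proof.
split => [||b b'|b]; first exact: mt_linr.
- exact: mt_1.
- by rewrite -mt_M mulr1.
- by rewrite -mt_star star1.
Qed.

(** The two embeddings [a ⊗ 1] and [1 ⊗ b] are star-homomorphisms, hence contractive. *)
Lemma norm_tens_le a b : `|a ⊗ b| <= `|a| * `|b|.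
Proof.
rewrite tens_split (le_trans (cnormM _ _))// ler_pM//.
  exact: (star_hom_contractive star_hom_tensl).
exact: (star_hom_contractive star_hom_tensr).
Qed.

Lemma unitary_tens a b : unitary a -> unitary b -> unitary (a ⊗ b).
Proof.
move=> [a1 a2] [b1 b2].
by split; rewrite -mt_star -mt_M (a1, a2) (b1, b2) mt_1.
Qed.

Lemma tens_dense : cspan (range (fun p : A * B => p.1 ⊗ p.2)) = setT.
Proof.
have := mt_dense M; rewrite -/(cspan _) => MT.
rewrite -MT; congr (cspan _); apply/seteqP; split => [_ [[a b] _ <-]|_ [a _ [b _ <-]]].
  by exists a => //; exists b.
by exists (a, b).
Qed.

Lemma tens_dense_sub (I J : Type) (e : I -> A) (f : J -> B) :
  cspan (range e) = setT -> cspan (range f) = setT ->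
  cspan (range (fun p : I * J => e p.1 ⊗ f p.2)) = setT.
Proof.
move=> eT fT; apply/seteqP; split=> // x _.
have : cspan (range (fun p : A * B => p.1 ⊗ p.2)) x by rewrite tens_dense.
apply: cspan_sub => _ [[a b] _ <-] /=.
have : cspan (range e) a by rewrite eT.
apply: (cspan_image (mt_linl M b) (K := `|b|)) => // [y|_ [i _ <-]].
  by rewrite mulrC norm_tens_le.
have : cspan (range f) b by rewrite fT.
apply: (cspan_image (mt_linr M (e i)) (K := `|e i|)) => // [y|_ [j _ <-]].
  exact: norm_tens_le.
by apply: sub_cspan; exists (i, j).
Qed.

End MinTensor.

Section TensorHom.
Context {R : realType}.

(** Contractivity is immediate from the form of [mt_norm]: representations of [A'] and [B'] pull
    back along [f] and [g] to representations of [A] and [B], which are already among those tested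
    by the norm of [M]. *)
Lemma tensor_hom_exists (A A' B B' : cstarType R) (M : min_tensor A B)
    (N : min_tensor A' B') (f : A -> A') (g : B -> B') : star_hom f -> star_hom g ->
  exists F : M -> N, star_hom F /\
    forall a b, F (mt_tens M a b) = mt_tens N (f a) (g b).
Proof.
move=> fh gh.
have [||||||||F [Fh FP]] := @extend_star_hom R M N (A * B)
  (fun p => mt_tens M p.1 p.2) (fun p => mt_tens N (f p.1) (g p.2))
  (fun p q => (p.1 * q.1, p.2 * q.2)) (fun p => (star p.1, star p.2)) (1, 1).
- move=> s; pose s' := [seq (p.1 *: p.2.1, p.2.2) | p <- s].
  have -> : \sum_(p <- s) p.1 *: mt_tens M p.2.1 p.2.2
      = \sum_(p <- s') mt_tens M p.1 p.2.
    by rewrite big_map; apply: eq_bigr => p _; rewrite tensZl.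
  have -> : \sum_(p <- s) p.1 *: mt_tens N (f p.2.1) (g p.2.2)
      = \sum_(p <- [seq (f p.1, g p.2) | p <- s']) mt_tens N p.1 p.2.
    rewrite !big_map; apply: eq_bigr => p _ /=.
    by rewrite (linear_mapZ (star_hom_linear fh)) tensZl.
  apply/mt_norm => // H K pi rho pir rhor xi.
  have -> : tensor_apply pi rho [seq (f p.1, g p.2) | p <- s'] xi =
      tensor_apply (fun a => pi (f a)) (fun b => rho (g b)) s' xi.
    by rewrite /tensor_apply allpairs_mapl.
  have /mt_norm := lexx `|\sum_(p <- s') mt_tens M p.1 p.2|.
  by move=> /(_ (normr_ge0 _)); apply; exact: representation_comp.
- exact: tens_dense.
- exact: mt_1.
- by rewrite /= (star_hom1 fh) (star_hom1 gh) mt_1.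
- by move=> p q; rewrite mt_M.
- by move=> p q; rewrite /= (star_homM fh) (star_homM gh) mt_M.
- by move=> p; rewrite mt_star.
- by move=> p; rewrite /= (star_hom_star fh) (star_hom_star gh) mt_star.
- by exists F; split=> // a b; exact: (FP (a, b)).
Qed.

Context (tp : tensor_products R).

Lemma tensor_homP (A A' B B' : cstarType R) (f : A -> A') (g : B -> B') :
  star_hom f -> star_hom g -> star_hom (@tensor_hom R tp _ _ _ _ f g) /\
    forall a b, @tensor_hom R tp _ _ _ _ f g (mt_tens (tp A B) a b)
                = mt_tens (tp A' B') (f a) (g b).
Proof.
move=> fh gh; have [F FP] := tensor_hom_exists (tp A B) (tp A' B') fh gh.
by rewrite /tensor_hom; case: xgetP => [h _ hP|/(_ F)//].
Qed.

End TensorHom.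

(** * Characters of abelian groups *)

Section Characters.
Context {K : numClosedFieldType} {G : zmodType}.

Definition is_character (chi : G -> K) : Prop :=
  (forall x, `|chi x| = 1) /\ (forall x y, chi (x + y) = chi x * chi y).

(* Graphs of characters of subgroups of [G]. *)
Definition partial_character (P : set (G * K)) : Prop :=
  [/\ P (0, 1), forall p q, P p -> P q -> P (p.1 - q.1, p.2 / q.2),
      forall p, P p -> `|p.2| = 1 & forall z, P (0, z) -> z = 1].

(** Needed to extend a character over a torsion element with a nontrivial value. If [c] is not 1,
    any [n]-th root works; if [c = 1], a root of [1 + X + ... + X^(n-1)] does, since its value at 1
    is [n]. *)
Lemma root_neq1 (c : K) n : (1 < n)%N -> `|c| = 1 ->
  exists z, [/\ z != 1, `|z| = 1 & z ^+ n = c].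
Proof.
move=> n1 c1; have n0 : (0 < n)%N by exact: ltnW.
have norm1 z : `|z ^+ n| = 1 -> `|z| = 1.
  by rewrite normrX => /eqP; rewrite pexpr_eq1// => /eqP.
have [c_eq|c_neq] := eqVneq c 1; last first.
  exists (n.-root c); rewrite rootCK// norm1 ?rootCK//; split=> //.
  by apply: contra_neq c_neq => r1; rewrite -(rootCK n0 c) r1 expr1n.
pose p : {poly K} := \poly_(i < n) 1.
have szp : size p = n by rewrite size_poly_eq ?oner_neq0.
have /closed_rootP[z /rootP pz] : size p != 1%N by rewrite szp gtn_eqF.
have sum0 : \sum_(i < n) z ^+ i = 0.
  by move: pz; rewrite horner_poly; under eq_bigr do rewrite mul1r.
have zn : z ^+ n = 1 by apply/eqP; rewrite -subr_eq0 subrX1 sum0 mulr0.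
exists z; rewrite norm1 ?zn ?normr1//; split=> //.
apply/eqP => z1; move: sum0; rewrite z1; under eq_bigr do rewrite expr1n.
by rewrite sumr_const card_ord => /eqP; rewrite pnatr_eq0 gtn_eqF.
Qed.

Section PartialCharacter.
Variable P : set (G * K).
Hypothesis Pc : partial_character P.

Lemma pchar_neq0 p : P p -> p.2 != 0.
Proof. by case: Pc => _ _ P1 _ /P1 p1; rewrite -normr_gt0 p1. Qed.

Lemma pcharV p : P p -> P (- p.1, p.2^-1).
Proof.
case: Pc => P0 PB _ _ Pp; have := PB _ _ P0 Pp; by rewrite /= sub0r div1r.
Qed.

Lemma pcharM p q : P p -> P q -> P (p.1 + q.1, p.2 * q.2).
Proof.
case: Pc => _ PB _ _ Pp /pcharV Pq; have := PB _ _ Pp Pq.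
by rewrite /= opprK invrK.
Qed.

Lemma pcharX p n : P p -> P (p.1 *+ n, p.2 ^+ n).
Proof.
move=> Pp; elim: n => [|n IH]; first by case: Pc.
by rewrite mulrS exprS; exact: pcharM Pp IH.
Qed.

Lemma pchar_fun x z w : P (x, z) -> P (x, w) -> z = w.
Proof.
move=> Pz Pw; case: Pc => _ PB _ P1; have := PB _ _ Pz Pw.
rewrite /= subrr => /P1 /(congr1 (fun t => t * w)).
by rewrite divfK ?mul1r// (pchar_neq0 Pw).
Qed.

(** If [n] is the order of [h] modulo the domain of [P], the new value at [h] may be any [n]-th root
    of the value at [h *+ n]. Since [n] is not 1, the root can be chosen different from 1, and this
    is what makes characters separate points. *)
Lemma pchar_extend h : (forall z, ~ P (h, z)) ->
  exists Q z, [/\ partial_character Q, P `<=` Q, Q (h, z) & z != 1].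
Proof.
move=> hP; have [P0 PB P1 Pf] := Pc.
pose inD k := exists w, P (h *+ k, w).
have inDB k l : (l <= k)%N -> inD k -> inD l -> inD (k - l)%N.
  by move=> lk [w Pw] [v Pv]; exists (w / v); rewrite mulrnBr//; exact: PB Pw Pv.
(* The case [n = 0] means that no positive multiple of [h] lies in the domain; then the value is
   unconstrained and -1 is chosen. *)
have [n [z [nD Pn z1 nz1]]] : exists n z, [/\ forall k, inD k -> (n %| k)%N,
    P (h *+ n, z ^+ n), z != 1 & `|z| = 1].
  have [ex|nex] := pselect (exists k, (0 < k)%N && `[< inD k >]); last first.
    exists 0%N, (-1); split.
    - move=> k kD; case: k kD => // k kD; exfalso; apply: nex.
      by exists k.+1; exact/asboolP.
    - by rewrite mulr0n expr0.
    - by rewrite -subr_eq0 -opprD oppr_eq0 -[1 + 1]/(2%:R) pnatr_eq0.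
    - by rewrite normrN normr1.
  have [n /andP[n0 /asboolP[c Pc']] nmin] := ex_minnP ex.
  have n1 : (1 < n)%N.
    rewrite ltn_neqAle n0 andbT; apply/eqP => n_eq.
    by move: Pc'; rewrite -n_eq mulr1n; exact: hP.
  have [z [z1 nz zn]] := root_neq1 n1 (P1 _ Pc').
  exists n, z; split=> //; last by rewrite zn.
  move=> k kD; rewrite /dvdn; apply/eqP; apply: contrapT => /eqP; rewrite -lt0n => r0.
  have : (n <= k %% n)%N.
    apply: nmin; rewrite r0; apply/asboolP; rewrite modn_def.
    case: edivnP => q r kE _; rewrite /= -(addKn (q * n) r) -kE.
    apply: inDB => //; first by rewrite kE leq_addr.
    by exists (c ^+ q); rewrite mulnC mulrnA; exact: pcharX Pc'.
  by rewrite leqNgt ltn_mod n0.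
have z0 : z != 0 by rewrite -normr_gt0 nz1.
have hk k w : P (h *+ k, w) -> w = z ^+ k.
  move=> Pw; have /dvdnP[q kE] : (n %| k)%N by apply: nD; exists w.
  apply: (pchar_fun Pw); rewrite kE mulnC mulrnA exprM.
  exact: pcharX Pn.
(* Two natural numbers [a] and [b] encode the integer multiple [a - b] of [h]. *)
pose Q : set (G * K) := [set p | exists q a b,
  [/\ P q, p.1 = q.1 + h *+ a - h *+ b & p.2 = q.2 * z ^+ a / z ^+ b]].
have QP : P `<=` Q.
  by move=> p Pp; exists p, 0%N, 0%N; rewrite !mulr0n addr0 subr0 !expr0 mulr1 divr1.
exists Q, z; split=> //; last first.
  by exists (0, 1), 1%N, 0%N; rewrite mulr0n mulr1n add0r subr0 expr0 expr1 mul1r divr1.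
split; first exact: QP.
- move=> _ _ [p [a [b [Pp -> ->]]]] [q [c [d [Pq -> ->]]]] /=.
  exists (p.1 - q.1, p.2 / q.2), (a + d)%N, (b + c)%N; split; first exact: PB.
    rewrite !mulrnDr /= !opprD !opprK !addrA.
    by rewrite (ACl (1*4*2*6*3*5))/=.
  have q0 := pchar_neq0 Pq; rewrite !exprD /=.
  by field; rewrite q0 !expf_neq0.
- move=> _ [p [a [b [Pp _ ->]]]].
  by rewrite normf_div normrM !normrX nz1 !expr1n (P1 _ Pp) mul1r divr1.
(* Well-definedness of the extension: a relation over 0 puts a natural multiple of [h] in the domain
   of [P], where [hk] identifies its value as the matching power of [z]. *)
- move=> _ [p [a [b [Pp /= /esym pE ->]]]].
  have p0 := pchar_neq0 Pp.
  have [ab|/ltnW ba] := leqP a b.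
    have : P (h *+ (b - a), p.2).
      suff -> : h *+ (b - a) = p.1 by rewrite -surjective_pairing.
      rewrite mulrnBr//; apply/eqP; rewrite subr_eq -subr_eq0.
      by rewrite -oppr_eq0 opprB pE.
    move=> /hk ->; rewrite -exprD subnK// divff// expf_neq0//.
  have : P (h *+ (a - b), p.2^-1).
    suff -> : h *+ (a - b) = - p.1 by exact: pcharV.
    rewrite mulrnBr//; apply/eqP; rewrite eq_sym -subr_eq0 -oppr_eq0 opprB opprK.
    by rewrite addrC addrA pE.
  move=> /hk pz; apply: (mulfI (invr_neq0 p0)).
  by rewrite mulr1 !mulrA mulVf// mul1r pz -{1}(subnK ba) exprD mulfK ?expf_neq0.
Qed.

End PartialCharacter.

(** [pchar_extend] is used twice: first to extend the character of the zero subgroup to [x] with a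
    nontrivial value, then to see that a maximal extension is defined everywhere. *)
Lemma character_separates (x : G) : x != 0 -> exists2 chi, is_character chi & chi x != 1.
Proof.
move=> x0; pose T0 : set (G * K) := [set (0, 1)].
have T0c : partial_character T0.
  split=> [|_ _ -> ->|_ ->|z [->]] //=; first by rewrite subrr divr1.
  by rewrite normr1.
have [|P0 [z [P0c T0P0 P0x z1]]] := pchar_extend T0c (h := x).
  by move=> z [/eqP]; rewrite (negbTE x0).
(* Adjoining [P0] makes the empty chain harmless and forces the maximal element to keep the value
   [z] at [x]. *)
have [|A [AP Amax]] := @Zorn_bigcup (G * K) [set X | partial_character (X `|` P0)].
  move=> F FP Ftot /=; set U := _ `|` P0.
  have two p q : U p -> U q -> exists X, [/\ partial_character X, X p, X q & X `<=` U].
    have sub X : F X -> X `|` P0 `<=` U.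
      by move=> FX; apply: setSU => y Xy; exists X.
    have P0U : P0 `<=` U by move=> ?; right.
    move=> [[X FX Xp]|Pp] [[Y FY Yq]|Pq].
    - have [XY|YX] := Ftot _ _ FX FY.
        exists (Y `|` P0); split; [exact: FP|by left; exact: XY|by left|exact: sub].
      exists (X `|` P0); split; [exact: FP|by left|by left; exact: YX|exact: sub].
    - by exists (X `|` P0); split; [exact: FP|left|right|exact: sub].
    - by exists (Y `|` P0); split; [exact: FP|right|left|exact: sub].
    - by exists P0.
  split.
  - by right; case: P0c.
  - by move=> p q Up Uq; have [X [[_ XB _ _] Xp Xq]] := two p q Up Uq; apply; exact: XB.
  - by move=> p Up; have [X [[_ _ X1 _] Xp _ _]] := two p p Up Up; exact: X1.
  - by move=> w Uw; have [X [[_ _ _ Xf] Xp _ _]] := two _ _ Uw Uw; exact: Xf.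
set P := A `|` P0 in AP.
have total h : exists w, P (h, w).
  apply: contrapT => /forallNP hP; have [Q [w [Qc PQ Qh _]]] := pchar_extend AP hP.
  apply: (Amax Q).
    rewrite properEneq; split; last by move=> y Ay; apply: PQ; left.
    by apply/eqP => AQ; apply: (hP w); left; rewrite AQ.
  rewrite /= (_ : Q `|` P0 = Q)//; apply/seteqP; split=> [y [//|P0y]|y]; last by left.
  by apply: PQ; right.
have [chi chiP] := choice total; have [_ _ P1 _] := AP.
exists chi; first split.
- by move=> y; exact: (P1 _ (chiP y)).
- by move=> y y'; apply: (pchar_fun AP (chiP _)); exact: (pcharM AP (chiP y) (chiP y')).
- by rewrite (pchar_fun AP (chiP x) (w := z))//; right.
Qed.

End Characters.

(** * The map id ⊗ Delta *)

Section EigenAverage.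
Context {R : realType} {V : normedModType R[i]}.

(* Averages [N^-1 (1 + beta + ... + beta^(N-1))] tend to the projection on the
   fixed vectors. *)
Lemma norm_fixed_part_le (beta : V -> V) (I : Type) (s : seq I) (x : I -> V) (z : I -> R[i]) :
  linear beta -> (forall v, `|beta v| <= `|v|) ->
  (forall i, beta (x i) = z i *: x i) -> (forall i, `|z i| = 1) ->
  `|\sum_(i <- s | z i == 1) x i| <= `|\sum_(i <- s) x i|.
Proof.
move=> bl bc bx z1.
have itE n (P : pred I) : iter n beta (\sum_(i <- s | P i) x i) =
    \sum_(i <- s | P i) z i ^+ n *: x i.
  elim: n => [|n IH]; first by apply: eq_bigr => i _; rewrite expr0 scale1r.
  rewrite iterS IH (linear_map_sum bl); apply: eq_bigr => i _.
  by rewrite (linear_mapZ bl) bx scalerA exprSr.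
have itc n v : `|iter n beta v| <= `|v|.
  by elim: n => [//|n IH]; rewrite iterS (le_trans (bc _)).
pose S N v := \sum_(n < N) iter n beta v.
set v := \sum_(i <- s) x i; set w := \sum_(i <- s | _) x i.
(* For [z] of modulus 1 other than 1, every partial geometric sum is bounded by [2 / |z - 1|]; hence
   the non-fixed part contributes at most [K] whatever the number of iterates. *)
pose K := \sum_(i <- s | z i != 1) 2 / `|z i - 1| * `|x i|.
have K0 : 0 <= K by apply: sumr_ge0 => i _; rewrite mulr_ge0// divr_ge0.
apply: (le_of_le_addV _ _ K0) => // n.
rewrite -(ler_pM2r (ltr0Sn _ n)) mulrDl divfK ?pnatr_eq0//.
have -> : `|w| * n.+1%:R = `|S n.+1 w|.
  have -> : S n.+1 w = n.+1%:R *: w.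
    rewrite /S (eq_bigr (fun=> w)); first by rewrite sumr_const card_ord scaler_nat.
    move=> k _; rewrite itE; apply: eq_bigr => i /eqP ->.
    by rewrite expr1n scale1r.
  by rewrite normrZ normr_nat mulrC.
have -> : S n.+1 w = S n.+1 v - S n.+1 (\sum_(i <- s | z i != 1) x i).
  rewrite /S -sumrB; apply: eq_bigr => k _; rewrite /v (itE k xpredT).
  by rewrite !itE [X in _ = X - _](bigID (fun i => z i == 1)) /= addrK.
rewrite (le_trans (ler_normB _ _))// lerD//.
  rewrite (le_trans (ler_norm_sum _ _ _))//.
  rewrite (@le_trans _ _ (\sum_(k < n.+1) `|v|))//; first by apply: ler_sum => k _.
  by rewrite sumr_const card_ord mulr_natr.
have -> : S n.+1 (\sum_(i <- s | z i != 1) x i) =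
    \sum_(i <- s | z i != 1) (\sum_(k < n.+1) z i ^+ k) *: x i.
  rewrite /S; under eq_bigr do rewrite itE.
  rewrite exchange_big /=.
  by apply: eq_bigr => i _; rewrite scaler_suml.
rewrite (le_trans (ler_norm_sum _ _ _))//; apply: ler_sum => i zi.
have zi0 : z i - 1 != 0 by rewrite subr_eq0.
rewrite normrZ ler_wpM2r// ler_pdivlMr ?normr_gt0// -normrM mulrC -subrX1.
by rewrite (le_trans (ler_normB _ _))// normrX z1 expr1n normr1.
Qed.

End EigenAverage.

(** * Fourier coefficients of finite sums over the group *)

Section FourierCoefficients.
Context {R : realType} (tp : tensor_products R) {G : zmodType} (C : group_cstar R G).
Context {A : cstarType R}.
Local Notation "a ⊗ b" := (mt_tens (tp _ _) a b) (at level 40, left associativity).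
Local Notation u := (gc_u C).

Lemma unitary_gc_u x : unitary (u x).
Proof. by have [] := gc_unitary C. Qed.

Lemma gc_uD x y : u (x + y) = u x * u y.
Proof. by have [] := gc_unitary C. Qed.

Lemma gc_u0 : u 0 = 1.
Proof. exact: unitary_rep0 (gc_unitary C). Qed.

Lemma gc_uN x : u (- x) = star (u x).
Proof. exact: unitary_repN (gc_unitary C). Qed.

Lemma norm_gc_u x : `|u x| = 1.
Proof. exact/norm_unitary/unitary_gc_u. Qed.

Lemma tens_gc_dense : cspan (range (fun p : A * G => p.1 ⊗ u p.2)) = setT.
Proof.
apply: (tens_dense_sub (tp A C) (e := idfun)); last exact: gc_dense.
by apply/seteqP; split=> // x _; apply: sub_cspan; exists x.
Qed.

Definition group_sum (s : seq (A * G)) : tp A C := \sum_(p <- s) p.1 ⊗ u p.2.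

(** Through the universal property this gives the dual action of [chi] on [C]. *)
Lemma character_rep (chi : G -> R[i]) : is_character chi ->
  unitary_representation (fun x => chi x *: u x).
Proof.
move=> [chi1 chiM]; split=> [x|x y]; last first.
  by rewrite gc_uD chiM -scalerAl -scalerAr scalerA.
have [u1 u2] := unitary_gc_u x; have cc : (chi x)^* * chi x = 1.
  by rewrite mulrC -normCK chi1 expr1n.
split; rewrite starZ -scalerAl -scalerAr scalerA.
  by rewrite cc u1 scale1r.
by rewrite mulrC cc u2 scale1r.
Qed.

(** The dual action of [chi], divided by [chi x], is contractive and multiplies the term at [g] by
    [chi g / chi x]; the terms kept are exactly those it fixes. *)
Lemma norm_character_part_le (chi : G -> R[i]) (s : seq (A * G)) (x : G) :
  is_character chi ->
  `|group_sum [seq p <- s | chi p.2 == chi x]| <= `|group_sum s|.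
Proof.
move=> chic; have [chi1 chiM] := chic.
have chi0 y : chi y != 0 by rewrite -normr_gt0 chi1.
have [ah au] := gc_liftP C (character_rep chic).
have [bh bt] := tensor_homP tp (star_hom_id A) ah.
set b := tensor_hom _ _ in bh bt.
pose beta v := (chi x)^-1 *: b v.
rewrite /group_sum big_filter.
have cond (p : A * G) : (chi p.2 == chi x) = (chi p.2 / chi x == 1).
  by rewrite -subr_eq0 -[RHS]subr_eq0 -{1}(mulfV (chi0 x)) -mulrBl mulf_eq0 invr_eq0
     (negbTE (chi0 x)) orbF.
rewrite (eq_bigl _ _ cond).
apply: (@norm_fixed_part_le _ _ beta _ s _ (fun p => chi p.2 / chi x)).
- by move=> k v w; rewrite /beta (star_hom_linear bh) scalerDr !scalerA mulrC.
- move=> v; rewrite normrZ normfV chi1 invr1 mul1r.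
  exact: star_hom_contractive.
- by move=> p; rewrite /beta bt au tensZr scalerA mulrC.
- by move=> p; rewrite normf_div !chi1 divr1.
Qed.

(** Each other element of the finite support is removed by a character separating it from [x];
    filtering by these characters in turn never increases the norm. *)
Lemma norm_coefficient_le (s : seq (A * G)) (x : G) :
  `|group_sum [seq p <- s | p.2 == x]| <= `|group_sum s|.
Proof.
have sep (L : seq G) : exists P : pred G, [/\ P x, forall y, y \in L -> y != x -> ~~ P y
    & forall t, `|group_sum [seq p <- t | P p.2]| <= `|group_sum t|].
  elim: L => [|y L [P [Px PL Pn]]].
    by exists xpredT; split=> // t; rewrite filter_predT.
  have [->|yx] := eqVneq y x.
    by exists P; split=> // z; rewrite inE => /predU1P[->|/PL//]; rewrite eqxx.
  have [|chi chic chi1] := @character_separates R[i] G (y - x); first by rewrite subr_eq0.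
  have [_ chiM] := chic.
  exists (fun z => (chi z == chi x) && P z); split.
  - by rewrite eqxx.
  - move=> z; rewrite inE => /predU1P[-> _|zL zx]; last by rewrite negb_and PL ?orbT.
    rewrite negb_and; apply/orP; left; apply: contraNneq chi1 => cyx.
    have [chin _] := chic; have cx0 : chi x != 0 by rewrite -normr_gt0 chin.
    by apply/eqP/(mulIf cx0); rewrite -chiM subrK mul1r.
  - move=> t; rewrite filter_predI (le_trans _ (Pn t))//.
    exact: norm_character_part_le.
have [P [Px PL Pn]] := sep (map snd s).
rewrite (_ : [seq p <- s | p.2 == x] = [seq p <- s | P p.2])//.
apply: eq_in_filter => p ps; have [->|px] := eqVneq p.2 x; first by rewrite Px.
by rewrite (negbTE (PL _ _ px))//; exact: map_f.
Qed.

End FourierCoefficients.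

Section Growth.
Context {R : realType}.

(** If [y < x], the powers of [y / x] decay exponentially in [2 ^ m] and beat the polynomial factor
    of degree [r]. *)
Lemma le_of_power_growth (x y : R[i]) (r : nat) : 0 <= x -> 0 <= y ->
  (forall m, x ^+ (2 ^ m) <= ((2 ^ m).+1 ^ r)%:R * y ^+ (2 ^ m)) -> x <= y.
Proof.
move=> x0 y0 le_xy; rewrite real_leNgt ?ger0_real//; apply/negP => ltyx.
have xp : 0 < x by exact: le_lt_trans ltyx.
pose q := y / x; have q0 : 0 <= q by rewrite divr_ge0.
have q1 : q < 1 by rewrite ltr_pdivrMr// mul1r.
have d0 : 0 < (2 ^ r.+1)%:R^-1 :> R[i] by rewrite invr_gt0 ltr0n expn_gt0.
have [N Nq] := small_expr q0 q1 d0.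
have sq l : (l.+1 * l <= 2 ^ (2 * l))%N.
  by rewrite mul2n -addnn expnD; apply: leq_mul; [|apply: ltnW]; apply: ltn_expl.
(* Since [q ^+ N] is below [2 ^ -(r + 1)], it is enough that [N * (m + 2)] be at most [2 ^ m]; for
   [m = 4 N] the product is [(2 N + 1) * (2 N)], which [sq] bounds. *)
pose k := (2 * N)%N; pose m := (2 * k)%N.
have mN : (N * (m + 2) <= 2 ^ m)%N.
  have -> : (N * (m + 2) = k.+1 * k)%N by rewrite /m /k; lia.
  exact: sq.
have qm : q ^+ (2 ^ m) <= (2 ^ (r.+1 * (m + 2)))%:R^-1.
  rewrite (le_trans (ler_wiXn2l q0 (ltW q1) mN))// exprM expnM natrX -exprVn.
  by rewrite lerXn2r ?nnegrE ?exprn_ge0 ?(ltW d0)// ltW.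
have xm : 0 < x ^+ (2 ^ m) by rewrite exprn_gt0.
have : (1 : R[i]) <= ((2 ^ m).+1 ^ r)%:R * q ^+ (2 ^ m).
  by rewrite expr_div_n mulrA ler_pdivlMr// mul1r.
move=> /le_trans/(_ (ler_wpM2l (ler0n R[i] ((2 ^ m).+1 ^ r)) qm)) /le_lt_trans le1.
suff /le1 : ((2 ^ m).+1 ^ r)%:R * (2 ^ (r.+1 * (m + 2)))%:R^-1 < 1 :> R[i] by rewrite ltxx.
rewrite ltr_pdivrMr ?ltr0n ?expn_gt0// mul1r ltr_nat.
have le2 : ((2 ^ m).+1 <= 2 ^ m.+1)%N by rewrite expnS mul2n -addnn -addn1 leq_add2l expn_gt0.
have le3 : ((2 ^ m).+1 ^ r <= 2 ^ (m.+1 * r))%N.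
  by rewrite expnM; case: (r) => // r'; rewrite leq_exp2r.
apply: (leq_ltn_trans le3); rewrite ltn_exp2l//.
lia.
Qed.

End Growth.

Section ComultiplicationNorm.
Context {R : realType} (tp : tensor_products R) {G : zmodType} (C : group_cstar R G).
Context {A : cstarType R}.
Local Notation "a ⊗ b" := (mt_tens (tp _ _) a b) (at level 40, left associativity).
Local Notation u := (gc_u C).
Local Notation v := (group_sum tp C).

Definition comul_sum (s : seq (A * G)) : tp (tp A C) C :=
  \sum_(p <- s) (p.1 ⊗ u p.2) ⊗ u p.2.
Local Notation w := comul_sum.

(** Collecting the terms by group element turns [w s] into a sum of Fourier coefficients tensored
    with unitaries, one for each point of the support. *)
Lemma norm_comul_sum_le_support (s : seq (A * G)) :
  `|w s| <= (size (undup (map snd s)))%:R * `|v s|.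
Proof.
have -> : w s = \sum_(g <- undup (map snd s)) v [seq p <- s | p.2 == g] ⊗ u g.
  transitivity (\sum_(g <- undup (map snd s)) \sum_(p <- s | p.2 == g)
                  (p.1 ⊗ u p.2) ⊗ u p.2); last first.
    apply: eq_bigr => g _; rewrite /group_sum big_filter.
    rewrite (linear_map_sum (mt_linl (tp (tp A C) C) (u g))).
    by apply: eq_bigr => p /eqP ->.
  rewrite (exchange_big_dep xpredT)//= /comul_sum big_seq [RHS]big_seq.
  apply: eq_bigr => p ps; rewrite [RHS]big_mkcond (bigD1_seq p.2) ?undup_uniq//=.
    by rewrite eqxx big1 ?addr0// => g; rewrite eq_sym => /negbTE ->.
  by rewrite mem_undup map_f.
rewrite (le_trans (ler_norm_sum _ _ _))//.
rewrite (@le_trans _ _ (\sum_(g <- undup (map snd s)) `|v s|))//.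
  apply: ler_sum => g _; rewrite (le_trans (norm_tens_le _ _ _))// norm_gc_u mulr1.
  exact: norm_coefficient_le.
by rewrite big_const_seq count_predT iter_addr_0 mulr_natl.
Qed.

(** Terms are not collected, so that [group_sum] and [comul_sum] are both multiplicative on the same
    lists; repetitions are discarded only when the support is counted. *)
Definition mul_terms (s t : seq (A * G)) : seq (A * G) :=
  [seq (p.1 * q.1, p.2 + q.2) | p <- s, q <- t].

Definition star_terms (s : seq (A * G)) : seq (A * G) :=
  [seq (star p.1, - p.2) | p <- s].

Lemma group_sumM s t : v (mul_terms s t) = v s * v t.
Proof.
rewrite /group_sum big_allpairs_dep big_distrlr /=.
by apply: eq_bigr => p _; apply: eq_bigr => q _; rewrite gc_uD mt_M.
Qed.

Lemma comul_sumM s t : w (mul_terms s t) = w s * w t.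
Proof.
rewrite /comul_sum big_allpairs_dep big_distrlr /=.
by apply: eq_bigr => p _; apply: eq_bigr => q _; rewrite gc_uD !mt_M.
Qed.

Lemma group_sum_star s : v (star_terms s) = star (v s).
Proof.
rewrite /group_sum big_map star_sum.
by apply: eq_bigr => p _; rewrite -mt_star gc_uN.
Qed.

Lemma comul_sum_star s : w (star_terms s) = star (w s).
Proof.
rewrite /comul_sum big_map star_sum.
by apply: eq_bigr => p _; rewrite -!mt_star gc_uN.
Qed.

(** All sums of the members of [t] with coefficients between 0 and [n]. As [G] is abelian, an
    [n]-fold sum of members of [t] lies here, which makes the growth polynomial of degree
    [size t]. *)
Fixpoint box (t : seq G) (n : nat) : seq G :=
  if t is h :: t' then [seq h *+ k + g | k <- iota 0 n.+1, g <- box t' n] else [:: 0].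

Lemma size_box t n : size (box t n) = (n.+1 ^ size t)%N.
Proof.
elim: t => // h t IH; rewrite -[box _ _]/([seq h *+ k + g | k <- iota 0 n.+1, g <- box t n]).
by rewrite size_allpairs IH size_iota expnS.
Qed.

Lemma box0 t n : 0 \in box t n.
Proof.
elim: t => [|h t IH]; first by rewrite inE.
apply/allpairsP; exists (0%N, 0); split; [by rewrite mem_iota|exact: IH|].
by rewrite mulr0n addr0.
Qed.

Lemma box1 t h : h \in t -> h \in box t 1.
Proof.
elim: t => // k t IH; rewrite inE => /predU1P[->|ht]; apply/allpairsP.
  exists (1%N, 0); split; rewrite ?mem_iota ?box0//.
  by rewrite mulr1n addr0.
by exists (0%N, h); split; rewrite ?mem_iota ?IH// mulr0n add0r.
Qed.

Lemma boxD t m n x y : x \in box t m -> y \in box t n -> x + y \in box t (m + n).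
Proof.
elim: t x y => [|h t IH] x y.
  by rewrite !inE => /eqP -> /eqP ->; rewrite addr0.
move=> /allpairsP[[k g] [km gm ->]] /allpairsP[[l g'] [ln gn ->]].
apply/allpairsP; exists ((k + l)%N, g + g'); split; last first.
- by rewrite /= mulrnDr addrACA.
- exact: IH.
by move: km ln; rewrite !mem_iota !leq0n !add0n !ltnS !andTb; exact: leq_add.
Qed.

Local Notation sqr_terms := (fun s => mul_terms s s).

(** For selfadjoint elements the C*-identity says that squaring squares the norm, which is why only
    exponents [2 ^ m] occur. *)
Lemma norm_iter_sqr (D : cstarType R) m (x : D) : star x = x ->
  `|iter m (fun y => y * y) x| = `|x| ^+ (2 ^ m).
Proof.
move=> sx; suff [] : `|iter m (fun y => y * y) x| = `|x| ^+ (2 ^ m) /\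
  star (iter m (fun y => y * y) x) = iter m (fun y => y * y) x by [].
elim: m => [|m [IH1 IH2]]; first by rewrite expr1.
rewrite iterS starMr IH2; split=> //.
by rewrite -{1}IH2 cnorm_starM IH1 -exprM expnSr.
Qed.

Lemma iter_sqr_terms s m :
  v (iter m sqr_terms s) = iter m (fun y => y * y) (v s) /\
  w (iter m sqr_terms s) = iter m (fun y => y * y) (w s).
Proof. by elim: m => //= m [IH1 IH2]; rewrite group_sumM comul_sumM IH1 IH2. Qed.

Lemma support_iter_sqr s m :
  {subset map snd (iter m sqr_terms s) <= box (map snd s) (2 ^ m)}.
Proof.
elim: m => [|m IH] x; first by move=> xs; exact: box1.
move=> /mapP[_ /allpairsP[[p q] [ps qs ->]] ->].
by rewrite expnS mul2n -addnn; apply: boxD; apply: IH; exact: map_f.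
Qed.

(* The C*-identity turns the bound by the size of the support, which grows polynomially
   along powers of [s^* s], into a contraction. *)
Lemma norm_comul_sum_le s : `|w s| <= `|v s|.
Proof.
pose s0 := mul_terms (star_terms s) s.
have vs0 : v s0 = star (v s) * v s by rewrite group_sumM group_sum_star.
have ws0 : w s0 = star (w s) * w s by rewrite comul_sumM comul_sum_star.
suff : `|w s0| <= `|v s0| by rewrite vs0 ws0 !cnorm_starM ler_pXn2r ?nnegrE.
apply: (@le_of_power_growth _ _ _ (size (map snd s0))) => // m.
have [vm wm] := iter_sqr_terms s0 m.
rewrite -!norm_iter_sqr ?vs0 ?ws0 ?starMr ?starK// -vs0 -ws0 -vm -wm.
rewrite (le_trans (norm_comul_sum_le_support _))// ler_wpM2r// ler_nat -size_box.
apply: uniq_leq_size; first exact: undup_uniq.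
by move=> x; rewrite mem_undup; exact: support_iter_sqr.
Qed.

End ComultiplicationNorm.

Section IdTensorComul.
Context {R : realType} (tp : tensor_products R) {G : zmodType} (C : group_cstar R G).
Local Notation "a ⊗ b" := (mt_tens (tp _ _) a b) (at level 40, left associativity).
Local Notation u := (gc_u C).
Local Notation Delta := (gc_comul tp C).

Lemma gc_comulP : star_hom Delta /\ forall x, Delta (u x) = u x ⊗ u x.
Proof.
apply: gc_liftP; split=> [x|x y]; first by apply: unitary_tens; exact: unitary_gc_u.
by rewrite gc_uD mt_M.
Qed.

Lemma id_tensor_comul_exists (A : cstarType R) : exists F : tp A C -> tp (tp A C) C,
  star_hom F /\ forall a x, F (a ⊗ u x) = (a ⊗ u x) ⊗ u x.
Proof.
have [||||||||F [Fh FP]] := @extend_star_hom R (tp A C) (tp (tp A C) C) (A * G)%type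
  (fun p => p.1 ⊗ u p.2) (fun p => (p.1 ⊗ u p.2) ⊗ u p.2)
  (fun p q => (p.1 * q.1, p.2 + q.2)) (fun p => (star p.1, - p.2)) (1, 0).
- move=> s; have := norm_comul_sum_le tp C [seq (p.1 *: p.2.1, p.2.2) | p <- s].
  rewrite /comul_sum /group_sum !big_map /=.
  under eq_bigr do rewrite !tensZl.
  by under [X in _ <= `|X| -> _]eq_bigr do rewrite !tensZl.
- exact: tens_gc_dense.
- by rewrite gc_u0 mt_1.
- by rewrite gc_u0 !mt_1.
- by move=> p q; rewrite gc_uD mt_M.
- by move=> p q; rewrite gc_uD !mt_M.
- by move=> p; rewrite gc_uN mt_star.
- by move=> p; rewrite gc_uN !mt_star.
- by exists F; split=> // a x; exact: (FP (a, x)).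
Qed.

(** The definition prescribes the values on all [a ⊗ h], whereas the constructed map is known only
    on [a ⊗ u x]. Splitting [a ⊗ c] as [(a ⊗ 1) * (1 ⊗ c)] leaves two star-homomorphisms on [C] that
    agree on the unitaries. *)
Lemma id_tensor_comulP (A : cstarType R) :
  star_hom (@id_tensor_comul R tp C Delta A) /\
  forall a x, @id_tensor_comul R tp C Delta A (a ⊗ u x) = (a ⊗ u x) ⊗ u x.
Proof.
have [Dh Du] := gc_comulP.
have [jh jt] := tensor_homP tp (star_hom_tensr (tp A C)) (star_hom_id C).
have jDh := star_hom_comp Dh jh.
have [F [Fh FP]] := id_tensor_comul_exists A.
rewrite /id_tensor_comul; case: xgetP => [h _ [hh hP]|/(_ F)[]]; last first.
  split=> // a c; rewrite (tens_split _ a c) (star_homM Fh); congr (_ * _).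
    by rewrite -gc_u0 FP.
  have -> : F (1 ⊗ c) = (F \o (fun c => 1 ⊗ c)) c by [].
  rewrite (gc_hom_ext (star_hom_comp (star_hom_tensr (tp A C)) Fh) jDh)// => x.
  by rewrite /= FP Du jt.
split=> // a x; rewrite hP Du jt -!mt_M mul1r.
by rewrite mulr1.
Qed.

End IdTensorComul.

(** * Freeness of the coaction *)

Lemma star_hom_dense_eq {R : realType} (A D : cstarType R) (f g : A -> D) (I : Type)
    (e : I -> A) : cspan (range e) = setT -> star_hom f -> star_hom g ->
  (forall i, f (e i) = g (e i)) -> f =1 g.
Proof.
move=> eT fh gh fg.
apply: (@dense_eq _ _ _ f g (range e) 1 (star_hom_linear fh) (star_hom_linear gh)) => //.
- by move=> x; rewrite mul1r star_hom_contractive.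
- by move=> x; rewrite mul1r star_hom_contractive.
- by move=> _ [i _ <-].
Qed.

Section InnerProduct.
Context {R : realType} {H : hilbertType R}.
Implicit Types x y z : H.

Lemma innerDl x y z : inner (x + y) z = inner x z + inner y z.
Proof. by have := innerP 1 x y z; rewrite scale1r mul1r. Qed.

Lemma inner0l z : inner (0 : H) z = 0.
Proof. by apply: (addIr (inner (0 : H) z)); rewrite -innerDl !add0r. Qed.

Lemma innerZl k x z : inner (k *: x) z = k * inner x z.
Proof. by have := innerP k x 0 z; rewrite inner0l !addr0. Qed.

Lemma innerBl x y z : inner (x - y) z = inner x z - inner y z.
Proof. by rewrite innerDl -scaleN1r innerZl mulN1r. Qed.

Lemma inner0r z : inner z (0 : H) = 0.
Proof. by rewrite innerC inner0l rmorph0. Qed.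

Lemma innerDr x y z : inner z (x + y) = inner z x + inner z y.
Proof. by rewrite (innerC _ z) innerDl rmorphD (innerC x z) (innerC y z). Qed.

Lemma innerBr x y z : inner z (x - y) = inner z x - inner z y.
Proof. by rewrite (innerC _ z) innerBl rmorphB (innerC x z) (innerC y z). Qed.

Lemma inner_suml I (s : seq I) (F : I -> H) z :
  inner (\sum_(i <- s) F i) z = \sum_(i <- s) inner (F i) z.
Proof. exact: (big_morph (fun x => inner x z) (fun x y => innerDl x y z) (inner0l z)). Qed.

Lemma inner_sumr I (s : seq I) (F : I -> H) z :
  inner z (\sum_(i <- s) F i) = \sum_(i <- s) inner z (F i).
Proof. exact: (big_morph (fun x => inner z x) (fun x y => innerDr x y z) (inner0r z)). Qed.

End InnerProduct.

Section BoundedOperators.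
Context {R : realType} {H : hilbertType R} (B : bounded_operators H).
Implicit Types a b : B.
Local Notation act := (bo_act (b := B)).

Lemma bo_actP k a b x : act (k *: a + b) x = k *: act a x + act b x.
Proof. by have [_ []] := bo_rep B. Qed.

Lemma bo_act1 x : act 1 x = x.
Proof. by have [_ []] := bo_rep B. Qed.

Lemma bo_actM a b x : act (a * b) x = act a (act b x).
Proof. by have [_ []] := bo_rep B. Qed.

Lemma bo_act_star a x y : inner (act a x) y = inner x (act (star a) y).
Proof. by have [_ []] := bo_rep B. Qed.

Lemma bo_act_linear a : linear (act a).
Proof. by have [/(_ a)[]] := bo_rep B. Qed.

Lemma bo_actD a b x : act (a + b) x = act a x + act b x.
Proof. by have := bo_actP 1 a b x; rewrite !scale1r. Qed.

Lemma bo_act0 x : act 0 x = 0.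
Proof. by apply: (addIr (act 0 x)); rewrite -bo_actD !add0r. Qed.

Lemma bo_actZ k a x : act (k *: a) x = k *: act a x.
Proof. by have := bo_actP k a 0 x; rewrite bo_act0 !addr0. Qed.

Lemma bo_actB a b x : act (a - b) x = act a x - act b x.
Proof. by rewrite bo_actD -scaleN1r bo_actZ scaleN1r. Qed.

Lemma bo_act_sum I (s : seq I) (F : I -> B) x :
  act (\sum_(i <- s) F i) x = \sum_(i <- s) act (F i) x.
Proof. exact: (big_morph (act^~ x) (fun a b => bo_actD a b x) (bo_act0 x)). Qed.

Lemma bo_act_norm a x : `|act a x| <= `|a| * `|x|.
Proof. by have /bo_norm := lexx `|a|; apply. Qed.

Lemma bo_act_inj a b : (forall x, act a x = act b x) -> a = b.
Proof.
move=> ab; apply/eqP; rewrite -subr_eq0 -normr_le0; apply/bo_norm => // x.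
by rewrite bo_actB ab subrr normr0 mul0r.
Qed.

End BoundedOperators.

Section FreeCoaction.
Context {R : realType} (tp : tensor_products R) {G : zmodType} (C : group_cstar R G).
Context {H : hilbertType R} (B : bounded_operators H).
Local Notation "a ⊗ b" := (mt_tens (tp _ _) a b) (at level 40, left associativity).
Local Notation u := (gc_u C).
Local Notation Delta := (gc_comul tp C).
Local Notation A := (tp B C).

(* [B ⊗ C] acts on [H ⊗ H], with [C] acting through the trivial character of [G]. *)
Lemma norm_sum_le_group_sum (s : seq (B * G)) :
  `|\sum_(p <- s) p.1| <= `|group_sum tp C s|.
Proof.
have triv : unitary_representation (fun _ : G => 1 : B).
  by split=> [x|x y]; rewrite ?mulr1//; split; rewrite star1 mulr1.
have [eh eu] := gc_liftP C triv; set e := gc_lift _ in eh eu.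
set M := `|group_sum tp C s|; have M0 : 0 <= M by exact: normr_ge0.
apply/(bo_norm (b := B)) => // x.
have [->|x0] := eqVneq x 0.
  by rewrite (linear_map0 (bo_act_linear _)) normr0 mulr0.
pose s' := [seq (p.1, u p.2) | p <- s].
have sE : \sum_(p <- s') p.1 ⊗ p.2 = group_sum tp C s by rewrite big_map.
have := lexx M; rewrite {1}/M -sE => /(mt_norm (tp B C) s' (normr_ge0 _)).
(* The single test vector [x ⊗ x] is enough: the second leg contributes a factor [|x| ^+ 2] on both
   sides, cancelled because [x] is nonzero. *)
move=> /(_ H H _ _ (bo_rep B) (representation_comp eh (bo_rep B)) [:: (x, x)]).
rewrite /tensor_norm2 /tensor_apply.
have -> : [seq (bo_act p.1 y.1, bo_act (e p.2) y.2) | p <- s', y <- [:: (x, x)]] =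
    [seq (bo_act p.1 x, x) | p <- s].
  rewrite allpairs_mapl; elim: s {M M0 s' sE} => //= p s <-.
  by rewrite eu bo_act1.
rewrite !big_seq1 big_map /=.
under eq_bigr do rewrite big_map /=.
have -> : \sum_(p <- s) \sum_(q <- s)
      inner (bo_act p.1 x) (bo_act q.1 x) * inner x x =
    `|bo_act (\sum_(p <- s) p.1) x| ^+ 2 * `|x| ^+ 2.
  rewrite !inner_norm bo_act_sum inner_suml mulr_suml; apply: eq_bigr => p _.
  by rewrite inner_sumr mulr_suml.
rewrite -!inner_norm mulrA ler_pM2r ?exprn_gt0 ?normr_gt0//.
by rewrite -exprMn ler_pXn2r ?nnegrE// mulr_ge0.
Qed.

(** This is [id ⊗ counit]; tensored with the identity of [C] it is a left inverse of [delta], whence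
    injectivity. *)
Lemma counit_slice : exists E : A -> B, star_hom E /\ forall b x, E (b ⊗ u x) = b.
Proof.
have [||||||||E [Eh EP]] := @extend_star_hom R A B (B * G)%type
  (fun p => p.1 ⊗ u p.2) fst
  (fun p q => (p.1 * q.1, p.2 + q.2)) (fun p => (star p.1, - p.2)) (1, 0) => //.
- move=> s; have := norm_sum_le_group_sum [seq (p.1 *: p.2.1, p.2.2) | p <- s].
  rewrite /group_sum !big_map /=.
  by under [X in _ <= `|X| -> _]eq_bigr do rewrite tensZl.
- exact: tens_gc_dense.
- by rewrite gc_u0 mt_1.
- by move=> p q; rewrite gc_uD mt_M.
- by move=> p; rewrite gc_uN mt_star.
- by exists E; split=> // a x; exact: (EP (a, x)).
Qed.

Lemma tens_gc_dense2 :
  cspan (range (fun p : (B * G) * G => (p.1.1 ⊗ u p.1.2) ⊗ u p.2)) = setT.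
Proof.
apply: (tens_dense_sub (tp A C) (e := fun p : B * G => p.1 ⊗ u p.2)).
  exact: tens_gc_dense.
exact: gc_dense.
Qed.

Lemma cspan_eq_setT (S : set (tp A C)) :
  (forall b x y, S ((b ⊗ u x) ⊗ u y)) -> cspan S = setT.
Proof.
move=> ST; apply/seteqP; split=> // z _.
have : cspan (range (fun p : (B * G) * G => (p.1.1 ⊗ u p.1.2) ⊗ u p.2)) z.
  by rewrite tens_gc_dense2.
by apply: cspan_sub => _ [[[b x] y] _ <-]; exact: sub_cspan.
Qed.

(** Both density conditions hold because every generator is a product of the required form:
    [(b ⊗ u x) ⊗ u y] is [delta (b ⊗ u x)] times [1 ⊗ u (y - x)], and also [(1 ⊗ u (x - y)) ⊗ 1]
    times [delta (b ⊗ u y)]. *)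
Lemma free_id_tensor_comul :
  free_coaction Delta (id_tensor_comul Delta (A := B) : A -> tp A C).
Proof.
have [Dh Dt] := id_tensor_comulP tp C B.
have [Dh2 Dt2] := id_tensor_comulP tp C A.
set delta := @id_tensor_comul R tp C Delta B in Dh Dt *.
have [dh dt] := tensor_homP tp Dh (star_hom_id C).
split; first split.
- exact: Dh.
- apply: (star_hom_dense_eq (tens_gc_dense tp C) (star_hom_comp Dh dh)
    (star_hom_comp Dh Dh2)) => -[b x] /=.
  by rewrite Dt dt Dt2 Dt.
- apply: cspan_eq_setT => b x y; exists (b ⊗ u x) => //; exists (u (y - x)) => //.
  by rewrite Dt -mt_M mulr1 -gc_uD addrC subrK.
- have [E [Eh Et]] := counit_slice.
  have [Fh Ft] := tensor_homP tp Eh (star_hom_id C).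
  apply: (@can_inj _ _ _ (@tensor_hom R tp _ _ _ _ E idfun)).
  apply: (star_hom_dense_eq (tens_gc_dense tp C) (star_hom_comp Dh Fh) (star_hom_id A)).
  by move=> -[b x] /=; rewrite Dt Ft Et.
- apply: cspan_eq_setT => b x y; exists (1 ⊗ u (x - y)) => //; exists (b ⊗ u y) => //.
  by rewrite Dt -!mt_M !mul1r -gc_uD subrK.
Qed.

End FreeCoaction.

(** * Halving a Hilbert space *)

(** The triangle inequality is part of the norm structure, so the bound follows by squaring it for
    [c *: x + y], with the phase [c] chosen to make the cross term equal to [|t|]. *)
Lemma cauchy_schwarz {R : realType} (H : hilbertType R) (x y : H) :
  `|inner x y| <= `|x| * `|y|.
Proof.
set t := inner x y; have [->|t0] := eqVneq t 0; first by rewrite normr0 mulr_ge0.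
have nt : `|t| != 0 by rewrite normr_eq0.
pose c := t^* / `|t|.
have c1 : `|c| = 1 by rewrite normf_div norm_conjC normr_id divff.
have ct : inner (c *: x) y = `|t|.
  by rewrite innerZl -/t mulrAC mulrC [t^* * t]mulrC -normCK expr2 mulKf.
have tc : inner y (c *: x) = `|t|.
  by rewrite (innerC (c *: x) y) ct; apply/CrealP; exact: normr_real.
have : `|c *: x + y| ^+ 2 <= (`|x| + `|y|) ^+ 2.
  rewrite ler_pXn2r ?nnegrE ?addr_ge0// (le_trans (ler_normD _ _))//.
  by rewrite normrZ c1 mul1r.
rewrite inner_norm innerDl !innerDr ct tc -!inner_norm normrZ c1 mul1r sqrrD.
rewrite -!addrA lerD2l !addrA lerD2r -!mulr2n.
by rewrite lerMn2r.
Qed.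

Section StrongLimit.
Context {R : realType} {H : hilbertType R} (B : bounded_operators H).
Local Notation act := (bo_act (b := B)).

(** By Pythagoras, [|q m x - q n x| ^+ 2] is a difference of terms of a bounded increasing sequence,
    so [q n x] is Cauchy. The limit operator is bounded and therefore comes from an element of
    [B]. *)
Lemma increasing_projections_cvg (q : nat -> B) :
  (forall n, star (q n) = q n) -> (forall m n, (m <= n)%N -> q m * q n = q m) ->
  exists Q : B, forall x, (fun n => act (q n) x) @ \oo --> act Q x.
Proof.
move=> qs qm; have qmr m n : (m <= n)%N -> q n * q m = q m.
  by move=> mn; rewrite -[LHS]starK starMr !qs qm// qs.
have q1 n : `|q n| <= 1.
  have := cnorm_starM (q n); rewrite qs qm// expr2 => qq.
  have [->//|q0] := eqVneq `|q n| 0.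
  by rewrite -(ler_pM2l (x := `|q n|)) ?lt0r ?q0//= mulr1 -qq.
have qx n x : `|act (q n) x| <= `|x|.
  by rewrite (le_trans (bo_act_norm _ _))// ler_piMl.
have pyth m n x : (m <= n)%N ->
    `|act (q m) x - act (q n) x| ^+ 2 = `|act (q n) x| ^+ 2 - `|act (q m) x| ^+ 2.
  move=> mn; rewrite !inner_norm innerBl !innerBr !bo_act_star -!bo_actM !qs.
  rewrite (qmr _ _ mn) (qm _ _ mn) !(qm _ _ (leqnn _)).
  by rewrite subrr sub0r opprB.
have cvg_q x : cvgn (fun n => act (q n) x).
  apply: complete_seq => e e0.
  pose a n := complex.Re (`|act (q n) x| ^+ 2).
  have aE n : (a n)%:C%C = `|act (q n) x| ^+ 2 by rewrite RRe_real// ger0_real// exprn_ge0.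
  have ubx : ubound (range a) (complex.Re (`|x| ^+ 2)).
    move=> _ [n _ <-]; rewrite -lecR aE RRe_real ?ger0_real ?exprn_ge0//.
    by rewrite ler_pXn2r ?nnegrE.
  have sa : has_sup (range a) by split; [exists (a 0%N); exists 0%N|eexists; exact: ubx].
  have e2 : 0 < complex.Re (e ^+ 2).
    by rewrite -ltcR RRe_real ?ger0_real ?exprn_ge0 ?ltW// exprn_gt0.
  have [_ [N _ <-] aN] := sup_adherent e2 sa.
  exists N => n Nn; rewrite -(@ltr_pXn2r _ 2) ?nnegrE ?(ltW e0)// pyth// -!aE -rmorphB.
  rewrite -[ltRHS]RRe_real ?ger0_real ?exprn_ge0 ?ltW// ltcR ltrBlDr -ltrBlDl.
  apply: le_lt_trans aN; rewrite lerD2r; apply: ub_le_sup; last by exists n.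
  by eexists; exact: ubx.
have exL x : exists l : H, (fun n => act (q n) x) @ \oo --> l.
  by have /cvg_ex := cvg_q x.
have [L LP] := choice exL.
have Ll : linear L.
  move=> k x y; apply: (cvg_unique _ (LP _)) => //=.
  under eq_fun do rewrite (bo_act_linear _ k x y).
  by apply: cvgD (LP y); apply: cvgZr; exact: LP.
have Lb x : `|L x| <= 1 * `|x|.
  apply: (@le_of_small _ _ _ 1) => // e e0 _.
  have /cvgrPdist_lt/(_ e e0)[N _ /(_ N (leqnn N)) /= LN] := LP x.
  rewrite -[L x](subrK (act (q N) x)) (le_trans (ler_normD _ _))// addrC !mul1r.
  by rewrite lerD// ltW.
have [|Q QL] := @bo_surj R H B L; first by split=> //; exists 1.
by exists Q => x; rewrite QL; exact: LP.
Qed.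

Lemma bo_act_cvg (Q : B) T (F : set_system T) (FF : Filter F) (f : T -> H) (l : H) :
  f @ F --> l -> (fun t => act Q (f t)) @ F --> act Q l.
Proof.
move=> /cvgrPdist_lt fl; apply/cvgrPdist_lt => e e0.
have K1 : 0 < `|Q| + 1 by rewrite ltr_wpDl.
near=> t; rewrite -(linear_mapB (bo_act_linear Q)).
rewrite (le_lt_trans (bo_act_norm _ _))// (@le_lt_trans _ _ ((`|Q| + 1) * `|l - f t|))//.
  by rewrite ler_wpM2r// lerDl.
rewrite -ltr_pdivlMl// mulrC; near: t; apply: fl.
by rewrite divr_gt0.
Unshelve. all: by end_near. Qed.

(* [Q] is the projection onto the sum of the mutually orthogonal ranges of
   [s ^+ n * e], i.e. the strong sum of the projections [s^n e (s^n)^*]. *)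
Lemma wandering_projection (s e : B) : star s * s = 1 -> star e = e -> e * e = e ->
  star s * e = 0 -> exists Q : B, [/\ star Q = Q, Q * Q = Q & Q = e + s * Q * star s].
Proof.
move=> ss es ee se; have es0 : e * s = 0.
  by rewrite -[LHS]starK starMr es se star0.
(* The partial sums of [s^k e (star s)^k], written as iterates so that the fixed-point equation for
   [Q] appears in the limit. *)
pose q n : B := iter n (fun x => e + s * x * star s) 0.
have qS n : q n.+1 = e + s * q n * star s by [].
have qs n : star (q n) = q n.
  elim: n => [|n IH]; first exact: star0.
  by rewrite qS starD !starMr starK es IH mulrA.
have qq m n : (m <= n)%N -> q m * q n = q m.
  elim: m n => [|m IH] [|n]//; rewrite ?mul0r// => mn.
  rewrite !qS mulrDl !mulrDr ee !mulrA es0 !mul0r addr0.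
  rewrite -[s * q m * star s * e]mulrA se mulr0 add0r; congr (_ + _).
  by rewrite -[s * q m * star s * s]mulrA ss mulr1 -[s * q m * q n]mulrA IH.
have [Q QP] := increasing_projections_cvg qs qq.
(* Taking adjoints is not continuous for strong convergence, so selfadjointness passes to the limit
   through inner products. *)
have innQ x y : inner (act Q x) y = inner x (act Q y).
  apply/eqP; rewrite -subr_eq0 -normr_le0.
  apply: (@le_of_small _ _ _ (`|y| + `|x|)); rewrite ?normr_real ?addr_ge0//.
  move=> d d0 _; rewrite add0r.
  near \oo => n.
  have -> : inner (act Q x) y - inner x (act Q y) =
      inner (act Q x - act (q n) x) y - inner x (act Q y - act (q n) y).
    by rewrite innerBl innerBr (bo_act_star (q n)) qs opprB addrA subrK.
  rewrite (le_trans (ler_normB _ _))// mulrDl lerD// (le_trans (cauchy_schwarz _ _))//.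
    rewrite mulrC ler_wpM2l// ltW//; near: n.
    by have /cvgrPdist_lt/(_ _ d0) := QP x.
  rewrite ler_wpM2l// ltW//; near: n.
  by have /cvgrPdist_lt/(_ _ d0) := QP y.
have Qs : star Q = Q.
  apply: (bo_act_inj (B := B)) => y; apply/eqP; rewrite -subr_eq0 -normr_le0.
  rewrite -(@ler_pXn2r _ 2) ?nnegrE// expr0n inner_norm innerBr -bo_act_star innQ subrr.
  by [].
have qQ n : q n * Q = q n.
  apply: (bo_act_inj (B := B)) => x; rewrite bo_actM.
  apply: (cvg_unique _ (bo_act_cvg _ (QP x))) => //=.
  apply: cvg_near_cst; exists n => // m /= nm.
  by rewrite -bo_actM qq.
exists Q; split=> //; apply: (bo_act_inj (B := B)) => x.
  rewrite bo_actM; apply: (cvg_unique _ (QP (act Q x))) => //=.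
  by under eq_fun do rewrite -bo_actM qQ; exact: QP.
have Qx1 : (fun n => act (q n.+1) x) @ \oo --> act Q x.
  by have := QP x; rewrite -(cvg_shiftS (fun n => act (q n) x)).
apply: (cvg_unique _ Qx1) => //=.
rewrite bo_actD !bo_actM.
under eq_fun do rewrite bo_actD !bo_actM.
by apply: cvgD; [exact: cvg_cst|apply: bo_act_cvg; exact: QP].
Unshelve. all: by end_near. Qed.

(* [H ≅ H ⊕ H] follows from [H ≅ H ⊕ H ⊕ H] by a Cantor-Schröder-Bernstein argument:
   [U] is a unitary from [H] onto the sum of the first two summands. *)
Lemma double_identification (S : 'I_3 -> B) : triple_identification S ->
  exists T0 T1 : B, double_isometry T0 T1.
Proof.
move=> [SS S1].
have [s0 s1 s2] : [/\ star (S 0) * S 0 = 1, star (S 1) * S 1 = 1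
    & star (S 2%:R) * S 2%:R = 1] by rewrite !SS.
have [s01 s02 s12] : [/\ star (S 0) * S 1 = 0, star (S 0) * S 2%:R = 0
    & star (S 1) * S 2%:R = 0] by rewrite !SS.
have sum : S 0 * star (S 0) + S 1 * star (S 1) + S 2%:R * star (S 2%:R) = 1.
  rewrite -S1 !big_ord_recr big_ord0 /= add0r.
  by congr (S _ * star (S _) + S _ * star (S _) + S _ * star (S _)); apply: val_inj.
move: (S 0) (S 1) (S 2%:R) s0 s1 s2 s01 s02 s12 sum => s t r ss tt rr st sr tr sum.
pose e := r * star r.
have [|||Q [Qs QQ Qe]] := @wandering_projection s e ss.
- by rewrite starMr starK.
- by rewrite /e mulrA -[r * star r * r]mulrA rr mulr1.
- by rewrite /e mulrA sr mul0r.
have sQ : s * Q = Q * s.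
  rewrite [in RHS]Qe mulrDl -[s * Q * star s * s]mulrA ss mulr1 /e -mulrA.
  have -> : star r * s = 0 by exact: star_mul0_sym.
  by rewrite mulr0 add0r.
have Qss : star s * Q = Q * star s.
  by rewrite -{1}Qs -starMr -sQ starMr Qs.
have [P PE] : exists P, P = 1 - Q by exists (1 - Q).
(* Hilbert's hotel: [U] shifts by [s] on the range of [Q] and is the identity elsewhere; it vacates
   exactly the third summand, so [U * star U = 1 - e]. *)
pose U := s * Q + P.
have Us : star U = Q * star s + P by rewrite starD starMr PE starB star1 Qs.
have QP0 : Q * P = 0 by rewrite PE mulrBr mulr1 QQ subrr.
have PQ0 : P * Q = 0 by rewrite PE mulrBl mul1r QQ subrr.
have PP : P * P = P by rewrite {2}PE mulrBr mulr1 PQ0 subr0.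
have UU : star U * U = 1.
  rewrite Us /U mulrDl !mulrDr PP mulrA -[Q * star s * s]mulrA ss mulr1 QQ.
  rewrite -Qss -[star s * Q * _]mulrA QP0 mulr0 addr0 sQ mulrA PQ0 mul0r add0r.
  by rewrite PE addrC subrK.
have UU' : U * star U = 1 - e.
  rewrite Us /U mulrDl !mulrDr PP mulrA -[s * Q * Q]mulrA QQ.
  rewrite -[s * Q * P]mulrA QP0 mulr0 addr0 mulrA PQ0 mul0r add0r.
  rewrite PE; set X := s * Q * star s in Qe *.
  by rewrite {1}Qe opprD [- e - X]addrC (addrA 1) addrA (addrC X) subrK.
have e_s : (1 - e) * s = s.
  rewrite mulrBl mul1r /e -mulrA.
  have -> : star r * s = 0 by exact: star_mul0_sym.
  by rewrite mulr0 subr0.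
have e_t : (1 - e) * t = t.
  rewrite mulrBl mul1r /e -mulrA.
  have -> : star r * t = 0 by exact: star_mul0_sym.
  by rewrite mulr0 subr0.
have key x y : (1 - e) * y = y -> star (star U * x) * (star U * y) = star x * y.
  by move=> ey; rewrite starMr starK mulrA -[star x * U * _]mulrA UU' -mulrA ey.
exists (star U * s), (star U * t); rewrite /double_isometry !key//; split=> //.
rewrite !starMr !starK.
have -> : star U * s * (star s * U) = star U * (s * star s) * U by rewrite !mulrA.
have -> : star U * t * (star t * U) = star U * (t * star t) * U by rewrite !mulrA.
rewrite -mulrDl -mulrDr.
have -> : s * star s + t * star t = 1 - e by rewrite -sum addrK.
by rewrite -UU' mulrA UU mul1r UU.
Qed.

End StrongLimit.

(** * Homotopies of representations *)

Section Homotopy.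
Context {R : realType} {G : zmodType}.

Lemma cvg_precomp (V : normedModType R[i]) (w : R -> V) (c : R -> R) (t : R) :
  continuous w -> c @ t --> c t -> (fun s => w (c s)) @ t --> w (c t).
Proof. by move=> wc ct; exact: (cvg_comp _ _ ct (wc (c t))). Qed.

(* Paths are parametrized by [R] and constant outside [0, 1]. *)
Definition rep_homotopic (D : cstarType R) (f h : G -> D) : Prop :=
  exists w : R -> G -> D,
    [/\ forall x, continuous (fun t => w t x), forall t, unitary_representation (w t),
        forall t, t <= 0 -> w t = f & forall t, 1 <= t -> w t = h].

Section OneAlgebra.
Context {D : cstarType R}.
Implicit Types f h k : G -> D.

Lemma rep_homotopic_sym f h : rep_homotopic f h -> rep_homotopic h f.
Proof.
case=> w [wc wr w0 w1]; exists (fun t => w (1 - t)); split => [x t|t|t t0|t t1].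
- apply: (@cvg_precomp _ (fun t => w t x) (fun t => 1 - t)); first exact: wc.
  by apply: cvgB; [exact: cvg_cst|exact: cvg_id].
- exact: wr.
- by rewrite w1// lerBrDl gerDr.
- by rewrite w0// subr_le0.
Qed.

Lemma rep_homotopic_trans f h k :
  rep_homotopic f h -> rep_homotopic h k -> rep_homotopic f k.
Proof.
move=> [w [wc wr w0 w1]] [v [vc vr v0 v1]].
(* On each half of the line one of the two paths is constantly [h], so the formula concatenates them
   and is visibly continuous at the junction. *)
pose z t x := w (2 * t) x + v (2 * t - 1) x - h x.
have zw t : t <= 2^-1 -> z t = w (2 * t).
  move=> t2; apply/funext => x; rewrite /z v0 ?addrK//.
  by rewrite subr_le0 -ler_pdivlMl// mulr1.
have zv t : 2^-1 <= t -> z t = v (2 * t - 1).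
  move=> t2; apply/funext => x; rewrite /z w1; first by rewrite addrC addKr.
  by rewrite -ler_pdivrMl// mulr1.
exists z; split => [x t|t|t t0|t t1].
- have c2 : (fun s : R => 2 * s) @ t --> 2 * t.
    by apply: cvgMr; exact: cvg_id.
  apply: cvgB; last exact: cvg_cst; apply: cvgD.
    exact: (@cvg_precomp _ (fun s => w s x) (fun s => 2 * s)).
  apply: (@cvg_precomp _ (fun s => v s x) (fun s => 2 * s - 1)); first exact: vc.
  by apply: cvgB; [exact: c2|exact: cvg_cst].
- by have [t2|/ltW t2] := leP t 2^-1; [rewrite zw|rewrite zv].
- rewrite zw ?w0//; first by rewrite pmulr_rle0.
  by rewrite (le_trans t0)// invr_ge0.
- have t2 : 2^-1 <= t by rewrite (le_trans _ t1)// invf_le1// ler1n.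
  by rewrite zv// v1// lerBrDl -mulr2n -mulr_natr ler_pMr.
Qed.

Lemma rep_homotopic_refl f : unitary_representation f -> rep_homotopic f f.
Proof. by move=> fr; exists (fun=> f); split=> // x t; exact: cvg_cst. Qed.

Lemma rep_homotopic_mull (c : G -> D) f h : unitary_representation c ->
  (forall x d, c x * d = d * c x) -> rep_homotopic f h ->
  rep_homotopic (fun x => c x * f x) (fun x => c x * h x).
Proof.
move=> [cu cM] cc [w [wc wr w0 w1]]; exists (fun t x => c x * w t x); split.
- by move=> x t; apply: cvg_cmul; [exact: cvg_cst|exact: wc].
- move=> t; have [wu wM] := wr t; split=> [x|x y]; last first.
    by rewrite cM wM -!mulrA; congr (_ * _); rewrite mulrA cc mulrA.
  have [c1 c2] := cu x; have [wx1 wx2] := wu x; split; rewrite starMr.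
    by rewrite mulrA -[star _ * _ * _]mulrA c1 mulr1 wx1.
  by rewrite mulrA -[c x * _ * _]mulrA wx2 mulr1 c2.
- by move=> t t0; apply/funext => x; rewrite w0.
- by move=> t t1; apply/funext => x; rewrite w1.
Qed.

Definition rep_sum (T0 T1 : D) f h : G -> D :=
  fun x => T0 * f x * star T0 + T1 * h x * star T1.

Lemma rep_sum_rep T0 T1 f h : double_isometry T0 T1 ->
  unitary_representation f -> unitary_representation h ->
  unitary_representation (rep_sum T0 T1 f h).
Proof.
move=> [T00 T11 T01 T1E] fr hr; have [fu fM] := fr; have [hu hM] := hr.
have T10 := star_mul0_sym T01.
have rM x y : rep_sum T0 T1 f h (x + y) = rep_sum T0 T1 f h x * rep_sum T0 T1 f h y.
  have mid (a b c d : D) (P Q : D) : a * b * star P * (Q * c * d) = a * b * (star P * Q) * c * d.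
    by rewrite !mulrA.
  rewrite /rep_sum fM hM mulrDl !mulrDr !mid T00 T11 T01 T10 !mulr0 !mul0r !mulr1.
  by rewrite addr0 add0r !mulrA.
have rst x : star (rep_sum T0 T1 f h x) = rep_sum T0 T1 f h (- x).
  rewrite /rep_sum starD !starMr !starK (unitary_repN x fr) (unitary_repN x hr).
  by rewrite !mulrA.
have r0 : rep_sum T0 T1 f h 0 = 1.
  by rewrite /rep_sum (unitary_rep0 fr) (unitary_rep0 hr) !mulr1.
by split=> // x; split; rewrite rst -rM ?addNr ?subrr r0.
Qed.

Lemma rep_homotopic_sum T0 T1 f f' h h' : double_isometry T0 T1 ->
  rep_homotopic f f' -> rep_homotopic h h' ->
  rep_homotopic (rep_sum T0 T1 f h) (rep_sum T0 T1 f' h').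
Proof.
move=> T [w [wc wr w0 w1]] [v [vc vr v0 v1]].
exists (fun t => rep_sum T0 T1 (w t) (v t)); split.
- move=> x t; apply: cvgD; apply: cvg_cmul; do ?exact: cvg_cst.
    by apply: cvg_cmul; [exact: cvg_cst|exact: wc].
  by apply: cvg_cmul; [exact: cvg_cst|exact: vc].
- by move=> t; exact: rep_sum_rep.
- by move=> t t0; rewrite w0// v0.
- by move=> t t1; rewrite w1// v1.
Qed.

End OneAlgebra.

Lemma rep_homotopic_map (D E : cstarType R) (F : D -> E) (f h : G -> D) : star_hom F ->
  rep_homotopic f h -> rep_homotopic (F \o f) (F \o h).
Proof.
move=> Fh [w [wc wr w0 w1]]; exists (fun t => F \o w t); split.
- move=> x t; apply/cvgrPdist_lt => e e0.
  have /cvgrPdist_lt/(_ e e0) := wc x t; apply: filterS => s.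
  rewrite -(linear_mapB (star_hom_linear Fh)); apply: le_lt_trans.
  exact: star_hom_contractive.
- move=> t; have [wu wM] := wr t; split=> [x|x y]; first exact: star_hom_unitary.
  by rewrite /= wM (star_homM Fh).
- by move=> t t0; rewrite w0.
- by move=> t t1; rewrite w1.
Qed.

Lemma conj_star_hom (D : cstarType R) (W : D) : unitary W ->
  star_hom (fun d => W * d * star W).
Proof.
move=> [W1 W2]; split => [k a b||a b|a].
- by rewrite mulrDr mulrDl -scalerAr -scalerAl.
- by rewrite mulr1.
- by rewrite !mulrA -[W * a * star W * W]mulrA W1 mulr1.
- by rewrite !starMr starK mulrA.
Qed.

End Homotopy.

(** * Unitary equivalences used by the swindle *)

Section Absorption.
Context {R : realType} {D : cstarType R} (T0 T1 V0 V1 V2 : D).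
Hypothesis T : double_isometry T0 T1.
Hypotheses (V00 : star V0 * V0 = 1) (V11 : star V1 * V1 = 1) (V22 : star V2 * V2 = 1).
Hypotheses (V01 : star V0 * V1 = 0) (V02 : star V0 * V2 = 0) (V12 : star V1 * V2 = 0).
Hypothesis V_sum : V0 * star V0 + V1 * star V1 + V2 * star V2 = 1.

Let T00 : star T0 * T0 = 1. Proof. by case: T. Qed.
Let T11 : star T1 * T1 = 1. Proof. by case: T. Qed.
Let T01 : star T0 * T1 = 0. Proof. by case: T. Qed.
Let T_sum : T0 * star T0 + T1 * star T1 = 1. Proof. by case: T. Qed.

(** A rewriting system: once the products are expanded into words, these rules and the removal of
    zeros reduce every word to normal form. *)
Let relations_r x :=
  ((mulr_star_eq1 x T00, mulr_star_eq1 x T11, mulr_star_eq1 x V00, mulr_star_eq1 x V11,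
    mulr_star_eq1 x V22),
   (mulr_star_eq0 x T01, mulr_star_eq0 x V01, mulr_star_eq0 x V02, mulr_star_eq0 x V12),
   (mulr_star_eq0 x (star_mul0_sym T01), mulr_star_eq0 x (star_mul0_sym V01),
    mulr_star_eq0 x (star_mul0_sym V02), mulr_star_eq0 x (star_mul0_sym V12))).

(* A unitary between [H ⊕ (H ⊕ H ⊕ H)] and [H ⊕ H ⊕ H] merging the first two summands. *)
Definition absorber : D :=
  V0 * T0 * star T0 + V0 * T1 * star V0 * star T1
  + V1 * star V1 * star T1 + V2 * star V2 * star T1.

Let expand := (mulrDl, mulrDr, mulrA).
Let zero := (mulr0, mul0r, addr0, add0r).

Lemma star_absorber : star absorber =
  T0 * star T0 * star V0 + T1 * V0 * star T1 * star V0
  + T1 * V1 * star V1 + T1 * V2 * star V2.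
Proof. by rewrite /absorber !starD !starMr !starK !mulrA. Qed.

Lemma absorber_unitary : unitary absorber.
Proof.
split; rewrite star_absorber /absorber.
  rewrite !expand; do ?rewrite relations_r ?zero.
  rewrite -[RHS]T_sum -[X in _ = _ + X * _]mulr1 -V_sum.
  by rewrite !expand ?addrA.
rewrite !expand; do ?rewrite relations_r ?zero.
rewrite -[RHS]V_sum -[X in _ = X * _ + _ + _]mulr1 -T_sum.
by rewrite !expand ?addrA.
Qed.

(** The two copies of [f] merge inside the first summand: as [f] commutes with [T0] and [T1], the
    sum of the terms [T * f * star T] collapses to [f]. *)
Lemma absorber_conj (f h k : D) : T0 * f = f * T0 -> T1 * f = f * T1 ->
  absorber * (T0 * f * star T0
      + T1 * (V0 * f * star V0 + V1 * h * star V1 + V2 * k * star V2) * star T1)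
    * star absorber
  = V0 * f * star V0 + V1 * h * star V1 + V2 * k * star V2.
Proof.
move=> fT0 fT1; rewrite star_absorber /absorber.
rewrite !expand; do ?rewrite relations_r ?zero.
rewrite -[V0 * T0 * f]mulrA fT0 -[V0 * T1 * f]mulrA fT1 !mulrA.
rewrite -[V0 * f in RHS]mulr1 -T_sum.
by rewrite !expand ?addrA.
Qed.

End Absorption.

Section SwapSummands.
Context {R : realType} {D : cstarType R} (T0 T1 : D).
Hypothesis T : double_isometry T0 T1.

Let T00 : star T0 * T0 = 1. Proof. by case: T. Qed.
Let T11 : star T1 * T1 = 1. Proof. by case: T. Qed.
Let T01 : star T0 * T1 = 0. Proof. by case: T. Qed.
Let T10 : star T1 * T0 = 0. Proof. exact: star_mul0_sym. Qed.
Let T_sum : T0 * star T0 + T1 * star T1 = 1. Proof. by case: T. Qed.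

Let relations_r x := (mulr_star_eq1 x T00, mulr_star_eq1 x T11,
  mulr_star_eq0 x T01, mulr_star_eq0 x T10).
Let expand := (mulrDl, mulrDr, mulrA).
Let zero := (mulr0, mul0r, addr0, add0r).

Definition swapper : D := T0 * star T1 + T1 * star T0.

Lemma star_swapper : star swapper = swapper.
Proof. by rewrite /swapper starD !starMr !starK addrC. Qed.

Lemma swapper_unitary : unitary swapper.
Proof.
suff XX : swapper * swapper = 1 by split; rewrite star_swapper.
rewrite /swapper !expand; do ?rewrite relations_r ?zero.
by rewrite T_sum.
Qed.

Lemma swapper_conj (f h : D) :
  swapper * (T0 * f * star T0 + T1 * h * star T1) * star swapper
  = T0 * h * star T0 + T1 * f * star T1.
Proof.
rewrite star_swapper /swapper !expand; do ?rewrite relations_r ?zero.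
exact: addrC.
Qed.

End SwapSummands.

(** * The swindle *)

Section Connection.
Context {R : realType} (tp : tensor_products R) {G : zmodType} (C : group_cstar R G).
Context {H : hilbertType R} (B : bounded_operators H).
Local Notation "a ⊗ b" := (mt_tens (tp _ _) a b) (at level 40, left associativity).
Local Notation u := (gc_u C).
Local Notation A := (tp B C).

(** The retraction of the line onto [[0, 1]], which turns a path given on the interval into one with
    constant tails. *)
Definition clamp (t : R) : R := Num.min (Num.max t 0) 1.

Lemma clamp_in t : clamp t \in `[0, 1].
Proof. by rewrite in_itv /= /clamp le_min le_max lexx orbT ler01 ge_min lexx orbT. Qed.

Lemma clamp_le0 t : t <= 0 -> clamp t = 0.
Proof. by move=> t0; rewrite /clamp (max_r t0) min_l. Qed.

Lemma clamp_ge1 t : 1 <= t -> clamp t = 1.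
Proof. by move=> t1; rewrite /clamp max_l ?min_r// (le_trans _ t1). Qed.

Lemma continuous_clamp : continuous clamp.
Proof.
move=> t.
have t0 : {for t, continuous ((fun s : R => s : R^o) \max (fun=> 0 : R^o))}.
  by apply: continuous_max; [exact: cvg_id|exact: cvg_cst].
exact: (continuous_min t0 (cvg_cst (1 : R^o))).
Qed.

Lemma hom_path_homotopic (D : cstarType R) (f h : C -> D) :
  hom_path f h -> rep_homotopic (f \o u) (h \o u).
Proof.
move=> [phi [phic phih phi0 phi1]]; exists (fun t => phi (clamp t) \o u); split.
- move=> x t.
  have /subspace_continuousP/(_ _ (clamp_in t)) := phic.
  move=> /pointwise_cvgP/(_ (u x)) ph.
  apply: cvg_trans ph => P /= PP.
  apply: (@filterS _ (nbhs t) _ _ _ _ (continuous_clamp PP)) => s /=.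
  by apply; exact: clamp_in.
- move=> t; have ph := phih _ (clamp_in t); split=> [x|x y].
    by apply: star_hom_unitary ph _ _; exact: unitary_gc_u.
  by rewrite /= gc_uD (star_homM ph).
- by move=> t /clamp_le0 ->; rewrite phi0.
- by move=> t /clamp_ge1 ->; rewrite phi1.
Qed.

Let i x : A := 1 ⊗ u x.
Let j x : A := 1 ⊗ u (- x).
Let tau (x : G) : A := 1.

Lemma tens_gc_central x (d : A) : (1 ⊗ u x) * d = d * (1 ⊗ u x).
Proof.
set c := 1 ⊗ u x.
have l1 : linear (fun d => c * d) by move=> k a b; rewrite mulrDr -scalerAr.
have l2 : linear (fun d => d * c) by move=> k a b; rewrite mulrDl -scalerAl.
apply: (@dense_eq _ _ _ _ _ _ `|c| l1 l2 _ _ _ (tens_gc_dense tp C)) => //.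
- by move=> y; exact: cnormM.
- by move=> y; rewrite mulrC; exact: cnormM.
- by move=> _ [[b y] _ <-] /=; rewrite -!mt_M mul1r mulr1 -!gc_uD addrC.
Qed.

Let i_rep : unitary_representation i.
Proof.
split=> [x|x y]; last by rewrite /i gc_uD -mt_M mulr1.
exact: (star_hom_unitary (star_hom_tensr (tp B C)) (unitary_gc_u C x)).
Qed.

Let j_rep : unitary_representation j.
Proof.
have [iu iM] := i_rep; split=> [x|x y]; first exact: iu.
by rewrite /j opprD; exact: iM.
Qed.

Let tau_rep : unitary_representation tau.
Proof. by split=> [x|x y]; rewrite /tau ?mulr1//; split; rewrite star1 mulr1. Qed.

(* Writing [n] for the representation [x |-> 1 ⊗ u (n x)], the hypothesis gives
   [1 + 0 ~ 1 + (1 + (-1) + 0) = 1 + (-1) + 0 ~ 0] since [1 + 1] is unitarily equivalent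
   to [1]; multiplying by the central [-1] yields [0 + (-1) ~ -1], hence [0 + 1 ~ 1] by
   inversion on [G], and so [1 ~ 0 + 1 ~ 0]. *)
Lemma connected_id_triv : connected_representations tp C B -> rep_homotopic i tau.
Proof.
move=> [_ [S Sid /hom_path_homotopic path]].
have [t0 [t1 [t00 t11 t01 tE]]] := double_identification Sid.
have [SS S1] := Sid.
have sum : S 0 * star (S 0) + S 1 * star (S 1) + S 2%:R * star (S 2%:R) = 1.
  rewrite -S1 !big_ord_recr big_ord0 /= add0r.
  by congr (S _ * star (S _) + S _ * star (S _) + S _ * star (S _)); apply: val_inj.
have lh := star_hom_tensl (tp B C).
pose T0 : A := t0 ⊗ 1; pose T1 : A := t1 ⊗ 1.
have T : double_isometry T0 T1.
  by split; rewrite /T0 /T1 -!mt_star !star1 -!mt_M ?mulr1 ?t00 ?t11 ?t01 ?mt_1//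
     -?(linear_mapD (star_hom_linear lh)) ?tE ?(linear_map0 (star_hom_linear lh))// mt_1.
have [T00 T11 T01 TE] := T.
pose V k : A := S k ⊗ 1.
have VV k l : star (V k) * V l = (k == l)%:R.
  rewrite /V -mt_star star1 -mt_M mulr1 SS.
  by case: (k == l); [exact: mt_1|exact: (linear_map0 (star_hom_linear lh))].
have Vsum : V 0 * star (V 0) + V 1 * star (V 1) + V 2%:R * star (V 2%:R) = 1.
  by rewrite /V -!mt_star star1 -!mt_M mulr1
     -!(linear_mapD (star_hom_linear lh)) sum mt_1.
have cent x (b : B) : (b ⊗ 1) * i x = i x * (b ⊗ 1) by rewrite /i tens_comm.
pose sig x := V 0 * i x * star (V 0) + V 1 * j x * star (V 1)
              + V 2%:R * tau x * star (V 2%:R).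
have {path} path : rep_homotopic sig tau.
  have lift_u (v : G -> C) x : unitary_representation v -> gc_lift v (u x) = v x.
    by move=> vr; have [_ ->] := gc_liftP C vr.
  have ur := gc_unitary C.
  have nur : unitary_representation (fun x => u (- x)).
    by have [uu uM] := ur; split=> // x y; rewrite opprD uM.
  have cur : unitary_representation (fun _ : G => 1 : C).
    by split=> [x|x y]; rewrite ?mulr1//; split; rewrite star1 mulr1.
  move: path; rewrite /amplification /direct_sum3.
  set f := (X in rep_homotopic X _); set g := (X in rep_homotopic _ X).
  have -> : f = sig.
    apply/funext => x; rewrite /f /= /gc_id /gc_inv /gc_triv !lift_u//.
    by rewrite mt_1.
  have -> // : g = tau.
  by apply/funext => x; rewrite /g /= /gc_triv lift_u// mt_1.
(* This lets every change of identification be applied to a path, or undone, without moving its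
   trivial end. *)
have conj_tau (W : A) : unitary W -> (fun d => W * d * star W) \o tau = tau.
  by move=> [_ W2]; apply/funext => x; rewrite /tau /= mulr1.
have Ti x : T0 * i x = i x * T0 by exact: cent.
have Ti' x : T1 * i x = i x * T1 by exact: cent.
have one_three : rep_homotopic (rep_sum T0 T1 i tau) tau.
  pose W := absorber T0 T1 (V 0) (V 1) (V 2%:R).
  have WU : unitary W by apply: absorber_unitary => //; rewrite VV.
  have step1 := rep_homotopic_sum T (rep_homotopic_refl i_rep) (rep_homotopic_sym path).
  have {step1} := rep_homotopic_map (conj_star_hom WU) step1.
  have -> : (fun d => W * d * star W) \o rep_sum T0 T1 i sig = sig.
    by apply/funext => x; rewrite /= /rep_sum absorber_conj// VV.
  move=> /rep_homotopic_trans/(_ path) step2.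
  have WU' : unitary (star W) by case: WU => W1 W2; split; rewrite starK.
  have := rep_homotopic_map (conj_star_hom WU') step2; rewrite conj_tau//.
  congr (rep_homotopic _ _); apply/funext => x; rewrite /= starK.
  by case: WU => W1 _; rewrite -!mulrA W1 mulr1 mulrA W1 mul1r.
have three_one : rep_homotopic (rep_sum T0 T1 tau i) i.
  have jcent x (d : A) : j x * d = d * j x by exact: tens_gc_central.
  have := rep_homotopic_mull j_rep jcent one_three.
  have [inv_h inv_u] : star_hom (gc_inv C) /\ forall x, gc_inv C (u x) = u (- x).
    apply: gc_liftP; have [uu uM] := gc_unitary C.
    by split=> // x y; rewrite opprD uM.
  (* [id ⊗ gc_inv] changes the sign of every exponent and fixes [T0] and [T1], whose second leg is
     1. *)
  have [Fh Ft] := tensor_homP tp (star_hom_id B) inv_h.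
  set F := tensor_hom _ _ in Fh Ft; move=> /(rep_homotopic_map Fh).
  have FT0 : F T0 = T0 by rewrite /T0 Ft (star_hom1 inv_h).
  have FT1 : F T1 = T1 by rewrite /T1 Ft (star_hom1 inv_h).
  have Fj x : F (j x) = i x by rewrite /j Ft inv_u opprK.
  have ji x : j x * i x = 1 by rewrite /j /i -mt_M mulr1 -gc_uD addNr gc_u0 mt_1.
  congr (rep_homotopic _ _); apply/funext => x; last by rewrite /= mulr1 Fj.
  rewrite /= /rep_sum mulrDr !mulrA !jcent -[T0 * j x * i x]mulrA ji.
  rewrite (linear_mapD (star_hom_linear Fh)) !(star_homM Fh) !(star_hom_star Fh).
  by rewrite FT0 FT1 /tau (star_hom1 Fh) !mulr1 Fj.
have swap : rep_homotopic (rep_sum T0 T1 tau i) tau.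
  have XU := swapper_unitary T.
  have := rep_homotopic_map (conj_star_hom XU) one_three; rewrite conj_tau//.
  congr (rep_homotopic _ _); apply/funext => x.
  by rewrite /= /rep_sum swapper_conj.
exact: rep_homotopic_trans (rep_homotopic_sym three_one) swap.
Qed.

End Connection.

(** * The equivariant map *)

(** An argument with three errors of size [d / 3]: the maps [F t] are uniformly contractive, so
    continuity in [t] passes from the generators to the closure of their span. *)
Lemma continuous_dense {R : realType} (V W : normedModType R[i]) (F : R -> V -> W)
    (I : Type) (e : I -> V) : (forall t, linear (F t)) ->
  (forall t x, `|F t x| <= `|x|) -> cspan (range e) = setT ->
  (forall i, continuous (fun t => F t (e i))) -> forall x, continuous (fun t => F t x).
Proof.
move=> Fl Fb eT Fe x t; apply/cvgrPdist_lt => d d0.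
have d3 : 0 < d / 3 by rewrite divr_gt0.
have /closure_approx/(_ _ d3)[y Sy xy] : cspan (range e) x by rewrite eT.
have Fy : continuous (fun t => F t y).
  apply: (@lspan_sub_submod _ _ (range e) (fun y => continuous (fun t => F t y))) Sy.
  - have -> : (fun t => F t 0) = fun=> 0 by apply/funext => s; exact: linear_map0.
    by move=> s; exact: cvg_cst.
  - move=> k a b Fa Fbb.
    have -> : (fun t => F t (k *: a + b)) = fun t => k *: F t a + F t b.
      by apply/funext => s; exact: Fl.
    by move=> s; apply: cvgD; [apply: cvgZr; exact: Fa|exact: Fbb].
  - by move=> _ [i _ <-]; exact: Fe.
have /cvgrPdist_lt/(_ _ d3) := Fy t; apply: filterS => s Fts.
have -> : F t x - F s x = F t (x - y) + (F t y - F s y) - F s (x - y).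
  by rewrite !(linear_mapB (Fl _)) addrA subrK opprB addrA subrK.
have -> : d = d / 3 + d / 3 + d / 3 by field.
rewrite (le_lt_trans (ler_normB _ _))// ltr_leD//; last by rewrite (le_trans (Fb _ _))// ltW.
by rewrite (le_lt_trans (ler_normD _ _))// ler_ltD// (le_trans (Fb _ _))// ltW.
Qed.

Section JoinMap.
Context {R : realType} (tp : tensor_products R) {G : zmodType} (C : group_cstar R G).
Context {H : hilbertType R} (B : bounded_operators H).
Local Notation "a ⊗ b" := (mt_tens (tp _ _) a b) (at level 40, left associativity).
Local Notation u := (gc_u C).
Local Notation Delta := (gc_comul tp C).
Local Notation A := (tp B C).

(** Writing [psi] at time [t] as [(W t ⊗ id)] after [Delta] makes it a star-homomorphism and reduces
    continuity to elementary tensors in [C ⊗ C]. Equivariance and both end conditions are equalities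
    of star-homomorphisms on [C], so they are checked on [u x]. *)
Lemma equivariant_hom_of_homotopy :
  rep_homotopic (fun x => 1 ⊗ u x : A) (fun=> 1) ->
  exists psi : C -> R -> tp A C,
    equivariant_hom Delta (id_tensor_comul Delta (A := B) : A -> tp A C) psi.
Proof.
move=> [w [wc wr w0 w1]].
have [Dh Du] := gc_comulP tp C.
have [dh dt] := id_tensor_comulP tp C B; have [dh' dt'] := id_tensor_comulP tp C A.
pose W t : C -> A := gc_lift (w t).
have Wh t : star_hom (W t) by have [] := gc_liftP C (wr t).
have Wu t x : W t (u x) = w t x by rewrite /W; have [_ ->] := gc_liftP C (wr t).
pose Z t : tp C C -> tp A C := tensor_hom (W t) idfun.
have Zh t : star_hom (Z t) by have [] := tensor_homP tp (Wh t) (star_hom_id C).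
have Zt t a b : Z t (a ⊗ b) = W t a ⊗ b.
  by rewrite /Z; have [_ ->] := tensor_homP tp (Wh t) (star_hom_id C).
pose psi h t := Z t (Delta h).
have psih t : star_hom (psi^~ t) := star_hom_comp Dh (Zh t).
have psiu t x : psi (u x) t = w t x ⊗ u x by rewrite /psi Du Zt Wu.
have psi_ext t (f : C -> tp A C) : star_hom f -> (forall x, f (u x) = w t x ⊗ u x) ->
    forall h, psi h t = f h.
  move=> fh fu h; have -> // : f = psi^~ t.
  by apply: gc_hom_ext => // x; rewrite fu psiu.
exists psi; split=> [h|t _|h t _]; first split.
- apply: continuous_subspaceT.
  apply: (@continuous_dense R (tp C C) (tp A C) Z (G * G)%type (fun p => u p.1 ⊗ u p.2)).
  + by move=> t; exact: star_hom_linear.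
  + by move=> t; exact: star_hom_contractive.
  + by apply: tens_dense_sub; exact: gc_dense.
  + move=> [x y] t /=; apply/cvgrPdist_lt => e e0.
    have /cvgrPdist_lt/(_ _ e0) := wc x t; apply: filterS => s.
    rewrite !Zt !Wu -(linear_mapB (mt_linl _ _)); apply: le_lt_trans.
    by rewrite (le_trans (norm_tens_le _ _ _))// norm_gc_u mulr1.
- exists (1 ⊗ h) => //; apply/esym.
  apply: (psi_ext 0 (id_tensor_comul Delta (A := B) \o (fun h => 1 ⊗ h))).
    exact: star_hom_comp (star_hom_tensr _) dh.
  by move=> x; rewrite /= dt w0.
- exists h; apply: (psi_ext 1 (fun h => 1 ⊗ h)); first exact: star_hom_tensr.
  by move=> x; rewrite w1.
- exact: psih.
- have [Ph Pt] := tensor_homP tp (psih t) (star_hom_id C).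
  suff : @id_tensor_comul R tp C Delta A \o psi^~ t =
      tensor_hom (psi^~ t) idfun \o Delta by move=> /(congr1 (@^~ h)).
  apply: gc_hom_ext; [exact: star_hom_comp|exact: star_hom_comp|move=> x].
  by rewrite /= psiu dt' Du Pt psiu.
Qed.

End JoinMap.

Theorem theorem4p1 (R : realType) (tp : tensor_products R) (G : zmodType)
    (C : group_cstar R G) (H : hilbertType R) (B : bounded_operators H)
    (connC : connected_representations tp C B) :
  let Delta := gc_comul tp C in
  let A := tp B C in
  let delta : A -> tp A C := id_tensor_comul Delta (A := B) in
  free_coaction Delta delta /\
  exists psi : C -> R -> tp A C, equivariant_hom Delta delta psi.
Proof.
move=> Delta A delta; split; first exact: free_id_tensor_comul.
exact/equivariant_hom_of_homotopy/connected_id_triv.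
Qed.
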